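(* Let $(X,\Omega)$ be a measurable space, let $A$ be a $\sigma$-monotone complete partially ordered algebra with a $\sigma$-monotone continuous multiplication, and let $\mu\colon\Omega\to A^+$ be a finite spectral measure. Then: (1) $I_\mu(f)\in\mu(X)A\mu(X)$ for $f\in\mathcal L^1(X,\Omega,\mu;\mathbb R)$; (2) the maps $I_\mu\colon\mathcal L^1(X,\Omega,\mu;\mathbb R)\to\mu(X)A$, $I_\mu\colon\mathcal L^1(X,\Omega,\mu;\mathbb R)\to A\mu(X)$, and $I_\mu\colon\mathcal L^1(X,\Omega,\mu;\mathbb R)\to\mu(X)A\mu(X)$ preserve moduli; (3) $\mathcal L^1(X,\Omega,\mu;\mathbb R)$ is a commutative unital vector lattice algebra; (4) when $I_\mu(\mathcal L^1(X,\Omega,\mu;\mathbb R))$ is supplied with the partial ordering inherited from $A$, it is a commutative unital vector lattice algebra with $\mu(X)$ as its positive multiplicative identity element. The map $I_\mu\colon\mathcal L^1(X,\Omega,\mu;\mathbb R)\to I_\mu(\mathcal L^1(X,\Omega,\mu;\mathbb R))$ is then a surjective unital vector lattice algebra homomorphism; (5) the kernel of $I_\mu\colon\mathcal L^1(X,\Omega,\mu;\mathbb R)\to A$ is $\mathcal N(X,\Omega,\mu;\mathbb R)$, so that the induced map $I_\mu\colon L^1(X,\Omega,\mu;\mathbb R)\to I_\mu(L^1(X,\Omega,\mu;\mathbb R))$ is an isomorphism of vector lattice algebras. The space $L^1(X,\Omega,\mu;\mathbb R)$ is $\sigma$-Dedekind complete, and $I_\mu\colon L^1(X,\Omega,\mu;\mathbb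 R)\to A$ is $\sigma$-order continuous. If, in addition, $A$ is monotone complete and has the countable sup property, then $L^1(X,\Omega,\mu;\mathbb R)$ is Dedekind complete, it has the countable sup property, and $I_\mu\colon L^1(X,\Omega,\mu;\mathbb R)\to A$ is order continuous.
   Context: All vector spaces are over $\mathbb R$; $\mathbb R^+=[0,\infty)$. A partially ordered vector space $E$ has a proper (not necessarily generating) positive cone $E^+$ and is always supposed to be Archimedean. $x_\lambda\uparrow x$ (resp. $x_\lambda\downarrow x$) means that $(x_\lambda)$ is an increasing (resp. decreasing) net with supremum (resp. infimum) $x$. $E$ is monotone complete (resp. $\sigma$-monotone complete) if every increasing net (resp. sequence) that is bounded above has a supremum. A vector lattice is ($\sigma$-)Dedekind complete if every non-empty (countable) subset that is bounded above has a supremum. $E$ has the countable sup property if, for every net $(x_\lambda)\subseteq E^+$ and $x\in E^+$ with $x_\lambda\uparrow x$, there is a countable set of indices $\{\lambda_n\}$ with $x=\sup_n x_{\lambda_n}$. A positive operator $T$ is order continuous (resp. $\sigma$-order continuous) if $Tx_\lambda\downarrow0$ for every net (resp. sequence) with $x_\lambda\downarrow 0$. An operator $T\colon E\to F$ between partially ordered vector spaces preserves moduli if, whenever $|x|=x\vee(-x)$ exists in $E$, $|Tx|$ exists in $F$ and $T|x|=|Tx|$. A partially ordered algebra $A$ is an associative algebra that is also a partially ordered vector space with $ab\in A^+$ for $a,b\in A^+$; no identity element is assumed; it is a vector lattice algebra if it is also a vector lattice. Its multiplication is $\sigma$-monotone continuous if, for all sequences in $A^+$ with $a_n\uparrow a\in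 A^+$, one has $ba_n\uparrow ba$ and $a_nb\uparrow ab$ for all $b\in A^+$. $\mu(X)A=\{\mu(X)a:a\in A\}$, etc., with the inherited ordering. A finite measure $\mu\colon\Omega\to A^+$ is a map with $\mu(\emptyset)=0$ and $\mu(\bigcup_n\Delta_n)=\bigvee_{N}\sum_{n=1}^N\mu(\Delta_n)$ in $A$ for every pairwise disjoint sequence in the $\sigma$-algebra $\Omega$; it is spectral if $\mu(\Delta_1\cap\Delta_2)=\mu(\Delta_1)\mu(\Delta_2)$ for all $\Delta_1,\Delta_2\in\Omega$. Order integral: for $\varphi=\sum_{i=1}^n r_i\chi_{\Delta_i}$ with $r_i\in\mathbb R^+$ and disjoint $\Delta_i\in\Omega$, $\int_X^{o}\varphi\,d\mu=\sum r_i\mu(\Delta_i)$; for measurable $f\colon X\to[0,\infty]$, $\int_X^{o}f\,d\mu=\bigvee_n\int_X^{o}\varphi_n\,d\mu$ in $A^+\cup\{\infty\}$ ($\infty$ adjoined as largest element) for any sequence of such $\varphi_n\uparrow f$ pointwise (independent of the choice). $\mathcal L^1(X,\Omega,\mu;\mathbb R)$ consists of the measurable $f\colon X\to\mathbb R$ with $\int_X^{o}|f|\,d\mu\in A$, and then $I_\mu(f)=\int^{o}_X f\,d\mu=\int^{o}_Xf^+\,d\mu-\int^{o}_Xf^-\,d\mu$. $\mathcal N(X,\Omega,\mu;\mathbb R)$ is the set of measurable functions that vanish $\mu$-almost everywhere, and $L^1(X,\Omega,\mu;\mathbb R)$ is the quotient $\mathcal L^1/\mathcal N$; the induced map on it is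 also denoted by $I_\mu$. Function spaces carry pointwise operations and order. *)

(* Defs.v *)
From HB Require Import structures.
From mathcomp Require Import all_boot all_order all_algebra.
From mathcomp Require Import generic_quotient ring_quotient.
From mathcomp Require Import all_classical all_reals all_analysis.
From mathcomp Require Import measurable_realfun.

Set Implicit Arguments.
Unset Strict Implicit.
Unset Printing Implicit Defensive.

Import Order.TTheory GRing.Theory Num.Theory.
Import numFieldNormedType.Exports.
Import HBNNSimple.

Local Open Scope classical_set_scope.
Local Open Scope ring_scope.

(* Properness of the positive cone is the antisymmetry of the order. *)
HB.mixin Record Lmodule_isPOVectorSpace (R : realType) E
    of GRing.Lmodule R E & Order.POrder ring_display E := {
  lev_wD2l : forall z x y : E, x <= y -> z + x <= z + y;
  scalev_ge0 : forall (r : R) (x : E), 0 <= r -> 0 <= x -> 0 <= r *: x;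
  archimedeanv : forall x y : E, (forall n, x *+ n.+1 <= y) -> x <= 0
}.

#[short(type="povsType")]
HB.structure Definition POVectorSpace (R : realType) :=
  {E of GRing.Lmodule R E & Order.POrder ring_display E &
        Lmodule_isPOVectorSpace R E}.

(* MathComp rings have an identity element, so the multiplication is taken from
   the semigroup structure and is written [(a * b)%g]. *)
HB.mixin Record Semigroup_isPOAlgebra (R : realType) A
    of POVectorSpace R A & Semigroup A := {
  mulvDl : forall a b c : A, ((a + b)%R * c)%g = (a * c)%g + (b * c)%g;
  mulvDr : forall a b c : A, (a * (b + c)%R)%g = (a * b)%g + (a * c)%g;
  scalevAl : forall (r : R) (a b : A), ((r *: a)%R * b)%g = r *: (a * b)%g;
  scalevAr : forall (r : R) (a b : A), (a * (r *: b)%R)%g = r *: (a * b)%g;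
  mulv_ge0 : forall a b : A, 0 <= a -> 0 <= b -> 0 <= (a * b)%g
}.

#[short(type="poalgType")]
HB.structure Definition POAlgebra (R : realType) :=
  {A of POVectorSpace R A & Semigroup A & Semigroup_isPOAlgebra R A}.

(* From here on a partially ordered vector space or algebra is a subset [S] of
   an ambient [povsType] or [poalgType], with the inherited operations and order;
   suprema and infima are taken within [S]. The whole space is [setT]. *)
Section order_notions.
Context {d : Order.disp_t} {T : porderType d}.
Implicit Types (S D : set T) (x y a : T) (u : nat -> T).

Definition is_sup S D a :=
  [/\ S a, ubound D a & forall b, S b -> ubound D b -> (a <= b)%O].

Definition is_inf S D a :=
  [/\ S a, lbound D a & forall b, S b -> lbound D b -> (b <= a)%O].

Definition seq_up S u a :=
  [/\ forall n, S (u n), nondecreasing_seq u & is_sup S (range u) a].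

Definition seq_down S u a :=
  [/\ forall n, S (u n), nonincreasing_seq u & is_inf S (range u) a].

Definition directed (I : Type) (leI : I -> I -> Prop) :=
  [/\ inhabited I, forall i, leI i i,
      forall i j k, leI i j -> leI j k -> leI i k
    & forall i j, exists k, leI i k /\ leI j k].

Definition increasing_net S (I : Type) (leI : I -> I -> Prop) (u : I -> T) :=
  [/\ directed leI, forall i, S (u i)
    & forall i j, leI i j -> (u i <= u j)%O].

Definition decreasing_net S (I : Type) (leI : I -> I -> Prop) (u : I -> T) :=
  [/\ directed leI, forall i, S (u i)
    & forall i j, leI i j -> (u j <= u i)%O].

Definition net_up S (I : Type) (leI : I -> I -> Prop) (u : I -> T) a :=
  increasing_net S leI u /\ is_sup S (range u) a.

Definition net_down S (I : Type) (leI : I -> I -> Prop) (u : I -> T) a :=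
  decreasing_net S leI u /\ is_inf S (range u) a.

Definition monotone_complete S :=
  forall (I : Type) (leI : I -> I -> Prop) (u : I -> T),
    increasing_net S leI u -> (exists2 b, S b & ubound (range u) b) ->
    exists a, is_sup S (range u) a.

Definition sigma_monotone_complete S :=
  forall u, (forall n, S (u n)) -> nondecreasing_seq u ->
    (exists2 b, S b & ubound (range u) b) -> exists a, is_sup S (range u) a.

Definition dedekind_complete S :=
  forall D, D `<=` S -> D !=set0 -> (exists2 b, S b & ubound D b) ->
    exists a, is_sup S D a.

Definition sigma_dedekind_complete S :=
  forall D, D `<=` S -> D !=set0 -> countable D ->
    (exists2 b, S b & ubound D b) -> exists a, is_sup S D a.

End order_notions.

Section vector_space_notions.
Context {R : realType} {E F : povsType R}.
Implicit Types (S : set E) (U : set F) (T : E -> F).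

Definition countable_sup_property S :=
  forall (I : Type) (leI : I -> I -> Prop) (u : I -> E) (a : E),
    net_up S leI u a -> (forall i, 0 <= u i) -> 0 <= a ->
    exists s : nat -> I, is_sup S (range (u \o s)) a.

Definition linear_subspace S :=
  S 0 /\ forall (r : R) x y, S x -> S y -> S (r *: x + y).

Definition vector_lattice S :=
  linear_subspace S /\
  forall x y, S x -> S y ->
    (exists z, is_sup S [set x; y] z) /\ (exists z, is_inf S [set x; y] z).

Definition is_modulus S x m := is_sup S [set x; - x] m.

Definition linear_operator S U T :=
  (forall x, S x -> U (T x)) /\
  forall (r : R) x y, S x -> S y -> T (r *: x + y) = r *: T x + T y.

Definition positive_operator S U T :=
  linear_operator S U T /\ forall x, S x -> 0 <= x -> 0 <= T x.

Definition order_continuous S U T :=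
  positive_operator S U T /\
  forall (I : Type) (leI : I -> I -> Prop) (u : I -> E),
    net_down S leI u 0 -> net_down U leI (T \o u) 0.

Definition sigma_order_continuous S U T :=
  positive_operator S U T /\
  forall u : nat -> E, seq_down S u 0 -> seq_down U (T \o u) 0.

Definition lattice_homomorphism S U T :=
  linear_operator S U T /\
  forall x y z, S x -> S y ->
    (is_sup S [set x; y] z -> is_sup U [set T x; T y] (T z)) /\
    (is_inf S [set x; y] z -> is_inf U [set T x; T y] (T z)).

End vector_space_notions.

Definition preserves_moduli (R : realType) (E F : povsType R)
    (S : set E) (U : set F) (T : E -> F) :=
  linear_operator S U T /\
  forall x m, S x -> is_modulus S x m -> is_modulus U (T x) (T m).

Section algebra_notions.
Context {R : realType} {A : poalgType R}.
Implicit Types (S : set A).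

Definition sigma_monotone_continuous_mul :=
  forall (u : nat -> A) (a : A), (forall n, 0 <= u n) -> 0 <= a ->
    seq_up setT u a ->
    forall b : A, 0 <= b ->
      seq_up setT (fun n => (b * u n)%g) (b * a)%g /\
      seq_up setT (fun n => (u n * b)%g) (a * b)%g.

Definition vector_lattice_algebra S :=
  vector_lattice S /\ forall a b, S a -> S b -> S (a * b)%g.

Definition commutative_on S :=
  forall a b, S a -> S b -> (a * b)%g = (b * a)%g.

Definition is_identity S e :=
  S e /\ forall a, S a -> (e * a)%g = a /\ (a * e)%g = a.

Definition commutative_unital_vector_lattice_algebra S :=
  [/\ vector_lattice_algebra S, commutative_on S & exists e, is_identity S e].

Definition left_multiples (p : A) : set A := [set (p * a)%g | a in setT].
Definition right_multiples (p : A) : set A := [set (a * p)%g | a in setT].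
Definition two_sided_multiples (p : A) : set A :=
  [set (p * a * p)%g | a in setT].

End algebra_notions.
Arguments sigma_monotone_continuous_mul {R} A.

Section algebra_homomorphisms.
Context {R : realType} {A B : poalgType R}.
Implicit Types (S : set A) (U : set B) (T : A -> B).

Definition vector_lattice_algebra_homomorphism S U T :=
  lattice_homomorphism S U T /\
  forall a b, S a -> S b -> T (a * b)%g = (T a * T b)%g.

Definition unital_map S U T :=
  forall e, is_identity S e -> is_identity U (T e).

Definition vector_lattice_algebra_isomorphism S U T :=
  vector_lattice_algebra_homomorphism S U T /\ set_bij S U T.

End algebra_homomorphisms.

Section measurable_functions.
Context {d : measure_display} {X : measurableType d} {R : realType}.
Local Notation M := {mfun X >-> R}.

HB.instance Definition _ :=
  [SubChoice_isSubPOrder of M by <: with ring_display].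

Lemma le_mfunP (f g : M) : reflect (forall x, f x <= g x) (f <= g).
Proof. exact: lefP. Qed.

Lemma mfunZ (r : R) (f : M) x : (r *: f) x = r * f x.
Proof. by []. Qed.

Let leD (h f g : M) : f <= g -> h + f <= h + g.
Proof. by move=> /le_mfunP fg; apply/le_mfunP => x; rewrite !mfunD /= lerD2l. Qed.

Let scale_ge0 (r : R) (f : M) : 0 <= r -> 0 <= f -> 0 <= r *: f.
Proof.
by move=> r0 /le_mfunP f0; apply/le_mfunP => x; rewrite mfunZ mulr_ge0// f0.
Qed.

Lemma archi_real (a b : R) : (forall n, a *+ n.+1 <= b) -> a <= 0.
Proof.
move=> H; rewrite leNgt; apply/negP => a0.
have b0 : 0 < b by apply: lt_le_trans (H 0%N); rewrite mulr1n.
have /archi_boundP := ltW (divr_gt0 b0 a0).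
rewrite ltr_pdivrMr// => bn.
have := H (Num.bound (b / a)); rewrite leNgt => /negP; apply.
by rewrite (lt_le_trans bn)// mulr_natl [leRHS]mulrS lerDr ltW.
Qed.

Let archi (f g : M) : (forall n, f *+ n.+1 <= g) -> f <= 0.
Proof.
move=> H; apply/le_mfunP => x; apply: (@archi_real _ (g x)) => n.
by have /le_mfunP/(_ x) := H n; rewrite mfunMn.
Qed.

HB.instance Definition _ := Lmodule_isPOVectorSpace.Build R M leD scale_ge0 archi.

HB.instance Definition _ := isSemigroup.Build M (@mulrA M).

Lemma mfun_mulgE (f g : M) : (f * g)%g = f * g. Proof. by []. Qed.

Let mulDl (a b c : M) : ((a + b)%R * c)%g = (a * c)%g + (b * c)%g.
Proof. exact: mulrDl. Qed.
Let mulDr (a b c : M) : (a * (b + c)%R)%g = (a * b)%g + (a * c)%g.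
Proof. exact: mulrDr. Qed.
Let scaleAl (r : R) (a b : M) : ((r *: a)%R * b)%g = r *: (a * b)%g.
Proof. by apply/mfuneqP => x; rewrite /= -[LHS]mulrA. Qed.
Let scaleAr (r : R) (a b : M) : (a * (r *: b)%R)%g = r *: (a * b)%g.
Proof. by apply/mfuneqP => x; rewrite /= -[LHS]mulrCA. Qed.
Let mul_ge0 (a b : M) : 0 <= a -> 0 <= b -> 0 <= (a * b)%g.
Proof.
move=> /le_mfunP a0 /le_mfunP b0; apply/le_mfunP => x.
by rewrite /= mulr_ge0// ?a0 ?b0.
Qed.

HB.instance Definition _ := Semigroup_isPOAlgebra.Build R M
  mulDl mulDr scaleAl scaleAr mul_ge0.

End measurable_functions.

Section measures.
Context {d : measure_display} (X : measurableType d) {R : realType}.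
Variable A : poalgType R.

(* Only the values on measurable sets are meaningful. *)
Record omeasure := OMeasure {
  omeasure_fun :> set X -> A;
  omeasure_ge0 : forall D, measurable D -> 0 <= omeasure_fun D;
  omeasure0 : omeasure_fun set0 = 0;
  omeasure_sigma_additive : forall F : nat -> set X,
    (forall n, measurable (F n)) -> trivIset setT F ->
    is_sup setT (range (fun N => \sum_(n < N.+1) omeasure_fun (F n)))
      (omeasure_fun (\bigcup_n F n))
}.

Definition spectral (mu : omeasure) :=
  forall D1 D2, measurable D1 -> measurable D2 ->
    mu (D1 `&` D2) = (mu D1 * mu D2)%g.

End measures.

Section almost_everywhere.
Context {d : measure_display} {X : measurableType d} {R : realType}.
Context {A : poalgType R} (mu : omeasure X A).
Local Notation M := {mfun X >-> R}.

Definition ae (P : X -> Prop) :=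
  exists N, [/\ measurable N, mu N = 0 & forall x, ~ P x -> N x].

Definition null_functions : set M := [set f | ae (fun x => f x = 0)].

Definition null_pred : {pred M} := fun f => `[< null_functions f >].

Lemma le_omeasure (D1 D2 : set X) : measurable D1 -> measurable D2 ->
  D1 `<=` D2 -> mu D1 <= mu D2.
Proof.
move=> m1 m2 D12; pose F := bigcup2 D1 (D2 `\` D1).
have mF n : measurable (F n).
  by case: n => [|[|n]] //=; [exact: measurableD | exact: measurable0].
have tF : trivIset setT F.
  by rewrite -trivIset_bigcup2 setDIK.
have [_ ub _] := omeasure_sigma_additive mu mF tF.
rewrite -[D2](setDUK D12) -bigcup2E.
suff -> : mu D1 = \sum_(n < 1) mu (F n) by apply: ub; exists 0%N.
by rewrite big_ord1.
Qed.

Lemma null_subset (D1 D2 : set X) : measurable D1 -> measurable D2 ->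
  D1 `<=` D2 -> mu D2 = 0 -> mu D1 = 0.
Proof.
move=> m1 m2 D12 D20; apply/le_anti/andP; split; last exact: omeasure_ge0.
by rewrite -D20 le_omeasure.
Qed.

Lemma null_bigcup (F : nat -> set X) : (forall n, measurable (F n)) ->
  (forall n, mu (F n) = 0) -> mu (\bigcup_n F n) = 0.
Proof.
move=> mF F0; rewrite seqDU_bigcup_eq.
have mG n : measurable (seqDU F n).
  by apply: measurableD => //; exact: bigsetU_measurable.
have [_ _ lub] := omeasure_sigma_additive mu mG (trivIset_seqDU F).
apply/le_anti/andP; split; last exact/omeasure_ge0/bigcupT_measurable.
apply: lub => // _ [N _ <-]; rewrite big1// => n _.
by apply: null_subset (F0 n) => //; exact: subset_seqDU.
Qed.

Lemma aeW (P : X -> Prop) : (forall x, P x) -> ae P.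
Proof. by move=> HP; exists set0; split; rewrite ?omeasure0// => x /(_ (HP x)). Qed.

Lemma aeS (P Q : X -> Prop) : (forall x, P x -> Q x) -> ae P -> ae Q.
Proof. by move=> PQ [N [mN N0 NP]]; exists N; split => // x nQ; apply: NP => /PQ. Qed.

Lemma ae_all (P : nat -> X -> Prop) :
  (forall n, ae (P n)) -> ae (fun x => forall n, P n x).
Proof.
move=> /choice[N NP]; exists (\bigcup_n N n); split.
- by apply: bigcupT_measurable => n; have [] := NP n.
- by apply: null_bigcup => n; have [] := NP n.
- by move=> x /existsNP[n nPx]; exists n => //; have [_ _] := NP n; exact.
Qed.

Lemma ae_and (P Q : X -> Prop) : ae P -> ae Q -> ae (fun x => P x /\ Q x).
Proof.
move=> aP aQ; have : forall n : nat, ae (if n is 0 then P else Q) by case.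
by move=> /ae_all; apply: aeS => x H; split; [exact: (H 0%N) | exact: (H 1%N)].
Qed.

Lemma null_pred_zmod_closed : zmod_closed null_pred.
Proof.
split; first by apply/asboolP/aeW.
move=> f g /asboolP f0 /asboolP g0; apply/asboolP.
by apply: aeS (ae_and f0 g0) => x [fx gx]; rewrite mfunB /= fx gx subr0.
Qed.

HB.instance Definition _ := GRing.isZmodClosed.Build M null_pred
  null_pred_zmod_closed.

End almost_everywhere.

(* All measurable functions modulo null functions; this is the ambient algebra
   of which the quotient L^1 / N is the subset [L1]. *)
Section quotient.
Context {d : measure_display} {X : measurableType d} {R : realType}.
Context {A : poalgType R} (mu : omeasure X A).
Local Notation M := {mfun X >-> R}.
Local Open Scope quotient_scope.

Definition mfun_ae : Type := {ideal_quot (null_pred mu)}.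

HB.instance Definition _ := GRing.Zmodule.on mfun_ae.
HB.instance Definition _ := EqQuotient.on mfun_ae.

Local Notation Q := mfun_ae.
Local Notation class := (\pi_Q : M -> Q).

Lemma eq_class (f g : M) : class f = class g <-> ae mu (fun x => f x = g x).
Proof.
split=> [/eqP|fg].
  rewrite -Quotient.idealrBE => /asboolP; apply: aeS => x.
  by rewrite mfunB /= => /eqP; rewrite subr_eq0 => /eqP.
apply/eqP; rewrite -Quotient.idealrBE; apply/asboolP; apply: aeS fg => x fg.
by rewrite mfunB /= fg subrr.
Qed.

Lemma ae_repr (f : M) : ae mu (fun x => repr (class f) x = f x).
Proof. by apply/eq_class; rewrite reprK. Qed.

Lemma classD (f g : M) : class (f + g) = class f + class g.
Proof. exact: raddfD. Qed.

Lemma class_ind (P : Q -> Prop) : (forall f, P (class f)) -> forall q, P q.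
Proof. by move=> HP q; rewrite -[q]reprK. Qed.

Definition scaleq (r : R) (p : Q) : Q := class (r *: repr p).
Definition mulq (p q : Q) : Q := class (repr p * repr q).
Definition leq_ae (p q : Q) : bool :=
  `[< ae mu (fun x => (repr p : M) x <= (repr q : M) x) >].
Definition ltq_ae (p q : Q) : bool := (q != p) && leq_ae p q.

Lemma classZ (r : R) (f : M) : scaleq r (class f) = class (r *: f).
Proof. by apply/eq_class; apply: aeS (ae_repr f) => x fx; rewrite !mfunZ fx. Qed.

Lemma class_mul (f g : M) : mulq (class f) (class g) = class (f * g).
Proof.
apply/eq_class; apply: aeS (ae_and (ae_repr f) (ae_repr g)) => x [fx gx].
by rewrite !mfunM /= fx gx.
Qed.

Lemma class_le (f g : M) :
  leq_ae (class f) (class g) <-> ae mu (fun x => f x <= g x).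
Proof.
have fg := ae_and (ae_repr f) (ae_repr g); split=> [/asboolP le|le].
  by apply: aeS (ae_and fg le) => x [[-> ->]].
by apply/asboolP; apply: aeS (ae_and fg le) => x [[-> ->]].
Qed.

Let scaleA a b (v : Q) : scaleq a (scaleq b v) = scaleq (a * b) v.
Proof. by elim/class_ind: v => v; rewrite !classZ scalerA. Qed.
Let scale1 : left_id 1 scaleq.
Proof. by elim/class_ind => v; rewrite !classZ scale1r. Qed.
Let scaleDr : right_distributive scaleq +%R.
Proof.
move=> a; elim/class_ind=> u; elim/class_ind=> v.
by rewrite -classD !classZ scalerDr classD.
Qed.
Let scaleDl v : {morph scaleq^~ v : a b / a + b >-> a + b}.
Proof.
by move=> a b; elim/class_ind: v => v; rewrite !classZ scalerDl classD.
Qed.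

HB.instance Definition _ :=
  GRing.Zmodule_isLmodule.Build R Q scaleA scale1 scaleDr scaleDl.

Let le_refl : reflexive leq_ae.
Proof. by elim/class_ind=> f; apply/class_le/aeW. Qed.
Let le_antisym : antisymmetric leq_ae.
Proof.
elim/class_ind=> f; elim/class_ind=> g /andP[/class_le fg /class_le gf].
apply/eq_class; apply: aeS (ae_and fg gf) => x [fgx gfx].
by apply/le_anti; rewrite fgx.
Qed.
Let le_transitive : transitive leq_ae.
Proof.
elim/class_ind=> g; elim/class_ind=> f; elim/class_ind=> h.
move=> /class_le fg /class_le gh; apply/class_le.
by apply: aeS (ae_and fg gh) => x [+ +]; exact: le_trans.
Qed.

HB.instance Definition _ := Order.isPOrder.Build ring_display Q
  (fun _ _ => erefl : ltq_ae _ _ = _) le_refl le_antisym le_transitive.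

Lemma le_classP (f g : M) :
  class f <= class g <-> ae mu (fun x => f x <= g x).
Proof. exact: class_le. Qed.

Let leD (r p q : Q) : p <= q -> r + p <= r + q.
Proof.
elim/class_ind: r => r; elim/class_ind: p => p; elim/class_ind: q => q.
move=> /le_classP pq; rewrite -!classD; apply/le_classP; apply: aeS pq => x.
by rewrite !mfunD /= lerD2l.
Qed.

Let scale_ge0 (r : R) (p : Q) : 0 <= r -> 0 <= p -> 0 <= r *: p.
Proof.
elim/class_ind: p => p r0.
rewrite -[0](raddf0 class) => /le_classP p0; rewrite [_ *: _]classZ.
by apply/le_classP; apply: aeS p0 => x; rewrite mfunZ; exact: mulr_ge0.
Qed.

Let archi (p q : Q) : (forall n, p *+ n.+1 <= q) -> p <= 0.
Proof.
elim/class_ind: p => p; elim/class_ind: q => q.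
rewrite -[0](raddf0 class) => H; apply/le_classP.
have /ae_all : forall n, ae mu (fun x => (p *+ n.+1) x <= q x).
  by move=> n; apply/le_classP; rewrite raddfMn.
apply: aeS => x pq; apply: (@archi_real _ _ (q x)) => n.
by have := pq n; rewrite mfunMn.
Qed.

HB.instance Definition _ := Lmodule_isPOVectorSpace.Build R Q
  leD scale_ge0 archi.

Let mul_assoc : associative mulq.
Proof.
elim/class_ind=> f; elim/class_ind=> g; elim/class_ind=> h.
by rewrite !class_mul mulrA.
Qed.

HB.instance Definition _ := isSemigroup.Build Q mul_assoc.

Let mulqE (f g : M) : (class f * class g)%g = class (f * g).
Proof. exact: class_mul. Qed.

Let mulDl (a b c : Q) : ((a + b)%R * c)%g = (a * c)%g + (b * c)%g.
Proof.
elim/class_ind: a => a; elim/class_ind: b => b; elim/class_ind: c => c.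
by rewrite -classD !mulqE mulrDl classD.
Qed.
Let mulDr (a b c : Q) : (a * (b + c)%R)%g = (a * b)%g + (a * c)%g.
Proof.
elim/class_ind: a => a; elim/class_ind: b => b; elim/class_ind: c => c.
by rewrite -classD !mulqE mulrDr classD.
Qed.
Let scaleAl (r : R) (a b : Q) : ((r *: a)%R * b)%g = r *: (a * b)%g.
Proof.
elim/class_ind: a => a; elim/class_ind: b => b.
rewrite [r *: class a]classZ !mulqE [RHS]classZ; congr (class _).
exact: (scalevAl r a b).
Qed.
Let scaleAr (r : R) (a b : Q) : (a * (r *: b)%R)%g = r *: (a * b)%g.
Proof.
elim/class_ind: a => a; elim/class_ind: b => b.
rewrite [r *: class b]classZ !mulqE [RHS]classZ; congr (class _).
exact: (scalevAr r a b).
Qed.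
Let mul_ge0 (a b : Q) : 0 <= a -> 0 <= b -> 0 <= (a * b)%g.
Proof.
elim/class_ind: a => a; elim/class_ind: b => b.
rewrite -[0](raddf0 class) => /le_classP a0 /le_classP b0.
rewrite mulqE; apply/le_classP; apply: aeS (ae_and a0 b0) => x [].
by rewrite mfunM; exact: mulr_ge0.
Qed.

HB.instance Definition _ := Semigroup_isPOAlgebra.Build R Q
  mulDl mulDr scaleAl scaleAr mul_ge0.

End quotient.

Section order_integral.
Context {d : measure_display} {X : measurableType d} {R : realType}.
Context {A : poalgType R} (mu : omeasure X A).
Local Notation M := {mfun X >-> R}.

(* [option A] is A with [None] adjoined as largest element infinity. *)
Definition le_ext (a b : option A) : Prop :=
  match a, b with
  | _, None => True
  | Some x, Some y => x <= y
  | None, Some _ => False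
  end.

Definition is_sup_ext (u : nat -> A) (v : option A) :=
  (forall n, le_ext (Some (u n)) v) /\
  forall w, (forall n, le_ext (Some (u n)) w) -> le_ext v w.

(* The sum runs over the finitely many values r of phi: it is the integral for
   the representation of phi by its disjoint level sets. *)
Definition oint_simple (phi : {nnsfun X >-> R}) : A :=
  \sum_(r \in [set: R]) r *: mu (phi @^-1` [set r]).

Definition is_oint (f : X -> \bar R) (v : option A) :=
  exists phi : nat -> {nnsfun X >-> R},
    [/\ forall x, nondecreasing_seq (fun n => phi n x),
        forall x, (fun n => (phi n x)%:E) @ \oo --> f x
      & is_sup_ext (fun n => oint_simple (phi n)) v].

(* For measurable f >= 0 and A sigma-monotone complete, [is_oint f] holds of
   exactly one value, whatever the approximating sequence. *)
Definition oint (f : X -> \bar R) : option A := xget None [set v | is_oint f v].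

Definition cL1 : set M :=
  [set f | exists a, oint (fun x => `|f x|%:E) = Some a].

Definition Imu (f : M) : A :=
  odflt 0 (oint (fun x => (f^\+ x)%:E)) - odflt 0 (oint (fun x => (f^\- x)%:E)).

Definition L1 : set (mfun_ae mu) := \pi_(mfun_ae mu)%qT @` cL1.

Definition Imu_ae (q : mfun_ae mu) : A := Imu (repr q).

End order_integral.
Arguments Imu_ae {d X R A} mu q.
Arguments L1 {d X R A} mu.

(* Main.v *)
(** Since [mu] is spectral, the order integral is multiplicative on simple
    functions, and sigma-monotone continuity of the multiplication carries this
    over to L^1. Hence [Imu (\1_D * f) = mu D * Imu f]; splitting an upper bound
    b = mu(X) b of Imu f and Imu g as mu(D) b + mu(X \ D) b with D = {g <= f}
    shows that b dominates Imu (max f g). Everything about the order follows from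
    this, and Chebyshev's inequality identifies the kernel with the null
    functions. Monotone convergence gives the sequential completeness and
    continuity of L^1; for nets, monotone completeness and the countable sup
    property of A select an increasing sequence with the same supremum of
    integrals, and injectivity of the integral on L^1 shows that the supremum of
    this sequence bounds the whole net. *)
Require Import Defs.
From HB Require Import structures.
From mathcomp Require Import all_boot all_order all_algebra.
From mathcomp Require Import generic_quotient ring_quotient.
From mathcomp Require Import all_classical all_reals all_analysis.
From mathcomp Require Import measurable_realfun.
From mathcomp Require Import ring lra.

Set Implicit Arguments.
Unset Strict Implicit.
Unset Printing Implicit Defensive.

Import Order.TTheory GRing.Theory Num.Theory.
Import numFieldNormedType.Exports.
Import HBNNSimple.

Local Open Scope classical_set_scope.
Local Open Scope ring_scope.

(** Two suprema need not exist in [A], so [Imu (max f g)] is never compared with a supremum taken in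
    all of [A]: cutting a bound [b] into two pieces requires [b] to be fixed by [mu setT] on one
    side. Hence moduli are preserved into the multiples of [mu setT], and lattice operations into
    the image of the integral. Convergence in [A] is available only through upper bounds of monotone
    sequences. A simple function is therefore compared with an increasing sequence after shrinking
    it by a factor c < 1; this slack turns pointwise convergence into inequalities outside sets
    decreasing to the empty set, and the Archimedean property removes it afterwards. The detour for
    nets has a measure-theoretic cause: countably many almost-everywhere inequalities fail on one
    common null set, uncountably many need not. A pointwise supremum over a net is thus out of
    reach, and a bound found along a sequence has to be extended to the other indices by comparing
    integrals. *)

(** * Ordered vector spaces and their suprema *)

Section povs.
Context {R : realType} {E : povsType R}.
Implicit Types (x y z : E) (S D : set E).

Lemma lev_D2l z x y : (z + x <= z + y) = (x <= y).
Proof.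
by apply/idP/idP => [/(lev_wD2l (- z))|/lev_wD2l//]; rewrite !addKr.
Qed.

Lemma lev_D2r z x y : (x + z <= y + z) = (x <= y).
Proof. by rewrite ![_ + z]addrC lev_D2l. Qed.

Lemma lev_D x y z t : x <= y -> z <= t -> x + z <= y + t.
Proof. by move=> xy zt; apply: (@le_trans _ _ (y + z)); rewrite ?lev_D2l ?lev_D2r. Qed.

Lemma subv_ge0 x y : (0 <= y - x) = (x <= y).
Proof. by rewrite -(lev_D2r x 0) add0r subrK. Qed.

Lemma lev_subl x y z : (x - y <= z) = (x <= z + y).
Proof. by rewrite -(lev_D2r y (x - y)) subrK. Qed.

Lemma lev_subr x y z : (x <= z - y) = (x + y <= z).
Proof. by rewrite -(lev_D2r y x) subrK. Qed.

Lemma lev_N2 x y : (- x <= - y) = (y <= x).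
Proof. by rewrite -(lev_D2r (x + y) (- x)) addKr addrCA addNr addr0. Qed.

Lemma lev_Z2l (r : R) x y : 0 <= r -> x <= y -> r *: x <= r *: y.
Proof. by move=> r0; rewrite -subv_ge0 => /(scalev_ge0 _ _ r0); rewrite scalerBr subv_ge0. Qed.

Lemma lev_sum (I : Type) (s : seq I) (P : pred I) (F G : I -> E) :
  (forall i, P i -> F i <= G i) ->
  \sum_(i <- s | P i) F i <= \sum_(i <- s | P i) G i.
Proof. by move=> FG; elim/big_ind2 : _ => // *; exact: lev_D. Qed.

Lemma is_sup_uniq (d : Order.disp_t) (T : porderType d) (S D : set T) a b :
  is_sup S D a -> is_sup S D b -> a = b.
Proof. by move=> [Sa ua la] [Sb ub lb]; apply/le_anti; rewrite la// lb. Qed.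

(** Monotonicity makes the diagonal cofinal among the sums [u n + v m]; this is the order substitute
    for continuity of addition. *)
Lemma is_sup_seqD (u v : nat -> E) a b :
  nondecreasing_seq u -> nondecreasing_seq v ->
  is_sup setT (range u) a -> is_sup setT (range v) b ->
  is_sup setT (range (fun n => u n + v n)) (a + b).
Proof.
move=> iu iv [_ ua la] [_ vb lb]; split=> // [_ [n _ <-]|c _ uc].
  by apply: lev_D; [apply: ua; exists n|apply: vb; exists n].
rewrite -lev_subr; apply: la => // _ [n _ <-].
rewrite lev_subr addrC -lev_subr; apply: lb => // _ [m _ <-].
rewrite lev_subr addrC; apply: (@le_trans _ _ (u (maxn n m) + v (maxn n m))).
  by apply: lev_D; [apply/iu/leq_maxl|apply/iv/leq_maxr].
by apply: uc; exists (maxn n m).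
Qed.

Lemma is_sup_seqZ (r : R) (u : nat -> E) a : 0 < r ->
  is_sup setT (range u) a ->
  is_sup setT (range (fun n => r *: u n)) (r *: a).
Proof.
move=> r0 [_ ua la]; split=> // [_ [n _ <-]|c _ uc].
  by apply: lev_Z2l; [exact: ltW|apply: ua; exists n].
have rV : c = r *: (r^-1 *: c) by rewrite scalerA divff ?scale1r ?gt_eqF.
rewrite rV; apply: lev_Z2l; first exact: ltW.
apply: la => // _ [n _ <-].
have -> : u n = r^-1 *: (r *: u n) by rewrite scalerA mulVf ?scale1r ?gt_eqF.
by apply: lev_Z2l; [rewrite invr_ge0 ltW|apply: uc; exists n].
Qed.

Lemma subspaceN S x : linear_subspace S -> S x -> S (- x).
Proof. by move=> [S0 SD] Sx; have := SD (-1) x 0 Sx S0; rewrite addr0 scaleN1r. Qed.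

Lemma subspaceD S x y : linear_subspace S -> S x -> S y -> S (x + y).
Proof. by move=> [S0 SD] Sx Sy; have := SD 1 x y Sx Sy; rewrite scale1r. Qed.

Lemma subspaceB S x y : linear_subspace S -> S x -> S y -> S (x - y).
Proof. by move=> lS Sx Sy; apply: subspaceD => //; exact: subspaceN. Qed.

(** Negation reverses the order within [S], so the lattice statements below are proved for suprema
    and transferred to infima by this equivalence. *)
Lemma is_inf_opp S x y z : linear_subspace S ->
  is_inf S [set x; y] z <-> is_sup S [set - x; - y] (- z).
Proof.
move=> lS; have SN t : S t -> S (- t) by exact: subspaceN.
split=> [[Sz lz gz]|[Sz lz gz]].
  split; first exact: SN.
    by move=> _ [->|->]; rewrite lev_N2; apply: lz; [left|right].
  move=> b Sb ub; rewrite -[b]opprK lev_N2; apply: gz; first exact: SN.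
  by move=> _ [->|->]; rewrite -lev_N2 opprK; apply: ub; [left|right].
split; first by rewrite -[z]opprK; exact: SN.
  by move=> _ [->|->]; rewrite -lev_N2; apply: lz; [left|right].
move=> b Sb ub; rewrite -lev_N2; apply: gz; first exact: SN.
by move=> _ [->|->]; rewrite lev_N2; apply: ub; [left|right].
Qed.

Lemma vector_lattice_sup S : linear_subspace S ->
  (forall x y, S x -> S y -> exists z, is_sup S [set x; y] z) ->
  vector_lattice S.
Proof.
move=> lS supS; split=> // x y Sx Sy; split; first exact: supS.
have [||z zE] := supS (- x) (- y); try exact: subspaceN.
by exists (- z); apply/is_inf_opp => //; rewrite opprK.
Qed.

End povs.

Section povs_morphism.
Context {R : realType} {E F : povsType R}.
Implicit Types (S : set E) (U : set F) (T : E -> F).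

Lemma linear_operator0 S U T : linear_subspace S -> linear_operator S U T ->
  T 0 = 0.
Proof.
move=> [S0 _] [_ TD]; have := TD (-1) 0 0 S0 S0.
by rewrite scaler0 addr0 scaleN1r addNr.
Qed.

Lemma linear_operatorN S U T x : linear_subspace S -> linear_operator S U T ->
  S x -> T (- x) = - T x.
Proof.
move=> lS lT Sx; have := lT.2 (-1) x 0 Sx lS.1.
by rewrite addr0 (linear_operator0 lS lT) addr0 !scaleN1r.
Qed.

Lemma linear_operatorB S U T x y : linear_subspace S -> linear_operator S U T ->
  S x -> S y -> T (x - y) = T x - T y.
Proof.
move=> lS lT Sx Sy; have := lT.2 (-1) y x Sy Sx.
by rewrite !scaleN1r addrC => ->; rewrite addrC.
Qed.

Lemma lattice_homomorphism_sup S U T :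
  linear_subspace S -> linear_subspace U -> linear_operator S U T ->
  (forall x y z, S x -> S y -> is_sup S [set x; y] z ->
     is_sup U [set T x; T y] (T z)) ->
  lattice_homomorphism S U T.
Proof.
move=> lS lU lT supT; split=> // x y z Sx Sy; split; first exact: supT.
move=> /[dup] -[Sz _ _] /is_inf_opp-/(_ lS) /supT.
move=> /(_ (subspaceN lS Sx) (subspaceN lS Sy)).
by rewrite !(linear_operatorN lS lT)// => ?; exact/is_inf_opp.
Qed.

End povs_morphism.

(** * Arithmetic and monotonicity of the product *)

Section poalgebra.
Context {R : realType} {A : poalgType R}.
Implicit Types a b c : A.

Lemma mulv0 a : (a * 0)%g = 0 :> A.
Proof. by rewrite -[in LHS](scale0r (0 : A)) scalevAr scale0r. Qed.

Lemma mul0v a : (0 * a)%g = 0 :> A.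
Proof. by rewrite -[in LHS](scale0r (0 : A)) scalevAl scale0r. Qed.

Lemma mulvN a b : (a * (- b)%R)%g = - (a * b)%g.
Proof. by rewrite -scaleN1r scalevAr scaleN1r. Qed.

Lemma mulNv a b : ((- a)%R * b)%g = - (a * b)%g.
Proof. by rewrite -scaleN1r scalevAl scaleN1r. Qed.

Lemma mulvBr a b c : (a * (b - c)%R)%g = (a * b)%g - (a * c)%g.
Proof. by rewrite mulvDr mulvN. Qed.

Lemma mulvBl a b c : ((a - b)%R * c)%g = (a * c)%g - (b * c)%g.
Proof. by rewrite mulvDl mulNv. Qed.

Lemma mulv_sumr (I : Type) (s : seq I) (F : I -> A) a :
  (a * (\sum_(i <- s) F i)%R)%g = \sum_(i <- s) (a * F i)%g.
Proof. by elim/big_rec2 : _ => [|i x y _ <-]; rewrite ?mulv0 ?mulvDr. Qed.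

Lemma mulv_suml (I : Type) (s : seq I) (F : I -> A) a :
  ((\sum_(i <- s) F i)%R * a)%g = \sum_(i <- s) (F i * a)%g.
Proof. by elim/big_rec2 : _ => [|i x y _ <-]; rewrite ?mul0v ?mulvDl. Qed.

Lemma lev_M2l a b c : 0 <= a -> b <= c -> (a * b)%g <= (a * c)%g.
Proof. by move=> a0; rewrite -subv_ge0 => /(mulv_ge0 _ _ a0); rewrite mulvBr subv_ge0. Qed.

Lemma lev_M2r a b c : 0 <= a -> b <= c -> (b * a)%g <= (c * a)%g.
Proof. by move=> a0; rewrite -subv_ge0 => /mulv_ge0 /(_ a0); rewrite mulvBl subv_ge0. Qed.

End poalgebra.

(** * Simple functions *)

Section measure_facts.
Context {d : measure_display} {X : measurableType d} {R : realType}.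
Context {A : poalgType R} (mu : omeasure X A).

(** The partial sums for [D1], [D2], empty, empty, ... are constant from the second one on, and the
    first is below them by positivity; so the supremum is the sum of two terms. *)
Lemma omeasureU (D1 D2 : set X) : measurable D1 -> measurable D2 ->
  D1 `&` D2 = set0 -> mu (D1 `|` D2) = mu D1 + mu D2.
Proof.
move=> m1 m2 D12; pose F := bigcup2 D1 D2.
have mF n : measurable (F n) by case: n => [|[|n]] //=; exact: measurable0.
have tF : trivIset setT F by rewrite -trivIset_bigcup2.
have sumF n : \sum_(i < n.+2) mu (F i) = mu D1 + mu D2.
  rewrite big_ord_recl big_ord_recl big1 ?addr0// => i _.
  by rewrite /F/= omeasure0.
have [_ ub lub] := omeasure_sigma_additive mu mF tF.
rewrite -bigcup2E; apply/le_anti/andP; split; last first.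
  by apply: ub; exists 1%N => //; exact: sumF.
apply: lub => // _ [[|N] _ <-]; last by rewrite sumF.
by rewrite big_ord1 -[leLHS]addr0 lev_D2l omeasure_ge0.
Qed.

Lemma omeasureC (D : set X) : measurable D -> mu (~` D) = mu setT - mu D.
Proof.
move=> mD; apply/eqP; rewrite eq_sym subr_eq addrC; apply/eqP.
by rewrite -omeasureU ?setUv ?setICr//; exact: measurableC.
Qed.

Lemma omeasure_bigcup_seq (I : choiceType) (s : seq I) (B : I -> set X) :
  uniq s -> (forall i, measurable (B i)) -> trivIset setT B ->
  mu (\big[setU/set0]_(i <- s) B i) = \sum_(i <- s) mu (B i).
Proof.
move=> + mB tB; elim: s => [|i s IH] /=; first by rewrite !big_nil omeasure0.
move=> /andP[nis us]; rewrite !big_cons -IH// omeasureU//.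
  exact: bigsetU_measurable.
rewrite -subset0 -bigcup_seq => x [Bix [j /= js Bjx]].
have ij : i = j by apply: tB => //; exists x.
by move: nis; rewrite ij js.
Qed.

(** Continuity from above at the empty set, in order form. The complements increase to [setT]; if
    [c] is below every [mu (E n)], then [mu setT - c] bounds a sequence whose supremum is
    [mu setT]. *)
Lemma omeasure_down (E : nat -> set X) c :
  (forall n, measurable (E n)) -> (forall n, E n.+1 `<=` E n) ->
  \bigcap_n E n = set0 -> (forall n, c <= mu (E n)) -> c <= 0.
Proof.
move=> mE dE E0 cE; pose D n := ~` E n.
have mD n : measurable (D n) by exact: measurableC.
have ndD : nondecreasing_seq D.
  by apply/nondecreasing_seqP => n; apply/subsetPset/subsetC/dE.
have mF n : measurable (seqD D n) by case: n => //= n; exact: measurableD.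
have sumF n : \sum_(i < n.+1) mu (seqD D i) = mu (D n).
  elim: n => [|n IH]; first by rewrite big_ord1.
  rewrite big_ord_recr/= IH -omeasureU//; last 2 first.
  - exact: measurableD.
  - by rewrite setDE setICA setICr setI0.
  by rewrite setDUK//; exact/subsetPset/ndD.
have [_ _ lub] := omeasure_sigma_additive mu mF (trivIset_seqD ndD).
have DT : \bigcup_n seqD D n = setT.
  by rewrite eq_bigcup_seqD -setC_bigcap E0 setC0.
have : mu setT <= mu setT - c.
  rewrite -DT; apply: lub => // _ [n _ <-].
  by rewrite sumF DT omeasureC// lev_D2l lev_N2.
by rewrite lev_subr -[leRHS]addr0 lev_D2l.
Qed.

End measure_facts.

Section simple_integral.
Context {d : measure_display} {X : measurableType d} {R : realType}.
Context {A : poalgType R} (mu : omeasure X A).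
Local Notation S := (oint_simple mu).
Implicit Types phi psi chi : {nnsfun X >-> R}.

(* [h] may take more values than [phi]: with [h] a pair of simple functions,
   this puts their integrals on a common partition. *)
Lemma oint_simple_comp (T : choiceType) (h : X -> T) (s : seq T) (g : T -> R)
    phi : uniq s -> (forall x, h x \in s) ->
  (forall t, measurable (h @^-1` [set t])) -> (forall x, phi x = g (h x)) ->
  S phi = \sum_(t <- s) g t *: mu (h @^-1` [set t]).
Proof.
move=> us hs mh phE; pose r := undup (map g s).
have phr x : phi x \in r by rewrite mem_undup phE map_f.
rewrite /oint_simple -(fsbig_widen [set` r] setT)//=; last first.
  move=> y [_ /= yr]; rewrite (_ : phi @^-1` _ = set0) ?omeasure0 ?scaler0//.
  by rewrite -subset0 => x /= xy; apply: yr; rewrite -xy; exact: phr.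
rewrite -fsbig_seq ?undup_uniq//.
transitivity (\sum_(y <- r) \sum_(t <- s | g t == y)
    g t *: mu (h @^-1` [set t])).
  apply: eq_bigr => y _; rewrite -big_filter.
  rewrite (eq_big_seq (fun t => y *: mu (h @^-1` [set t]))); last first.
    by move=> t; rewrite mem_filter => /andP[/eqP->].
  rewrite -scaler_sumr -omeasure_bigcup_seq ?filter_uniq//; last first.
    by move=> i j _ _ [x [/= <-]].
  rewrite -bigcup_seq; congr (_ *: mu _); apply/seteqP; split=> [x /= xy|x [t /=]].
    by exists (h x) => //=; rewrite mem_filter -phE xy eqxx hs.
  by rewrite mem_filter => /andP[/eqP <- _] /= <-; rewrite phE.
(* Each [t] lies in exactly one fibre of [g], so the inner sum keeps the single value [g t]. *)
rewrite (exchange_big_dep predT)//=; apply: eq_big_seq => t ts.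
rewrite -big_filter (_ : [seq _ <- r | _] = [:: g t]) ?big_seq1//.
have gtr : g t \in r by rewrite mem_undup map_f.
rewrite (_ : [seq _ <- r | _] = [seq y <- r | y == g t]).
  by rewrite filter_pred1_uniq// undup_uniq.
by apply: eq_filter => y /=; rewrite eq_sym.
Qed.

Lemma nnsfun_range phi : exists2 s : seq R, uniq s & forall x, phi x \in s.
Proof.
have /finite_seqP[s sE] : finite_set (range phi) by [].
exists (undup s); first exact: undup_uniq.
move=> x; rewrite mem_undup.
by have : [set` s] (phi x) by rewrite -sE; exists x.
Qed.

(** With [g] a projection this rewrites the integral of [phi] or [psi] itself on the common
    partition, so sums and inequalities can be compared term by term. *)
Lemma oint_simple_joint phi psi chi (g : R -> R -> R) (s r : seq R) :
  uniq s -> uniq r -> (forall x, phi x \in s) -> (forall x, psi x \in r) ->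
  (forall x, chi x = g (phi x) (psi x)) ->
  S chi = \sum_(a <- s) \sum_(b <- r)
    g a b *: mu (phi @^-1` [set a] `&` psi @^-1` [set b]).
Proof.
move=> us ur sP rP chiE; have preE t : (fun x => (phi x, psi x)) @^-1` [set t] =
    phi @^-1` [set t.1] `&` psi @^-1` [set t.2].
  by case: t => a b; apply/seteqP; split=> x /= [-> ->].
rewrite (@oint_simple_comp _ (fun x => (phi x, psi x))
  [seq (x, y) | x <- s, y <- r] (fun t => g t.1 t.2)) //.
- by rewrite big_allpairs; do 2 (apply: eq_bigr => ? _); rewrite preE.
- by apply: allpairs_uniq => // -[? ?] [? ?] _ _ [-> ->].
- by move=> x; apply/allpairsP; exists (phi x, psi x); split=> /=.
- by move=> t; rewrite preE; exact: measurableI.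
Qed.

Lemma oint_simpleD phi psi chi : (forall x, chi x = phi x + psi x) ->
  S chi = S phi + S psi.
Proof.
have [s us sP] := nnsfun_range phi; have [r ur rP] := nnsfun_range psi.
move=> chiE; rewrite (oint_simple_joint us ur sP rP chiE).
rewrite (@oint_simple_joint phi psi phi (fun a _ => a) s r)//.
rewrite (@oint_simple_joint phi psi psi (fun _ b => b) s r)//.
by do 2 (rewrite -big_split; apply: eq_bigr => ? _); exact: scalerDl.
Qed.

Lemma oint_simpleZ (r : R) phi chi : (forall x, chi x = r * phi x) ->
  S chi = r *: S phi.
Proof.
have [s us sP] := nnsfun_range phi; move=> chiE.
rewrite (@oint_simple_comp _ phi s (fun a => r * a) chi)//.
rewrite (@oint_simple_comp _ phi s id phi)//.
by rewrite scaler_sumr; apply: eq_bigr => t _; rewrite scalerA.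
Qed.

Lemma oint_simpleM phi psi chi : spectral mu ->
  (forall x, chi x = phi x * psi x) -> S chi = (S phi * S psi)%g.
Proof.
have [s us sP] := nnsfun_range phi; have [r ur rP] := nnsfun_range psi.
move=> sp chiE; rewrite (oint_simple_joint us ur sP rP chiE).
rewrite (@oint_simple_comp _ phi s id phi)//.
rewrite (@oint_simple_comp _ psi r id psi)//.
rewrite mulv_suml; apply: eq_bigr => a _; rewrite mulv_sumr.
by apply: eq_bigr => b _; rewrite sp// scalevAl scalevAr scalerA.
Qed.

Lemma oint_simple_le phi psi : (forall x, phi x <= psi x) -> S phi <= S psi.
Proof.
have [s us sP] := nnsfun_range phi; have [r ur rP] := nnsfun_range psi.
move=> le; rewrite (@oint_simple_joint phi psi phi (fun a _ => a) s r)//.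
rewrite (@oint_simple_joint phi psi psi (fun _ b => b) s r)//.
do 2 (apply: lev_sum => ? _); set D := _ `&` _.
(* A point of a nonempty cell compares the two values there; an empty cell has measure zero,
   whatever the values. *)
have [[x [xa xb]]|/set0P/negP/negPn/eqP->] :=
  pselect (D !=set0); last by rewrite omeasure0 !scaler0.
rewrite -subv_ge0 -scalerBl scalev_ge0//.
  by rewrite subr_ge0 -xa -xb.
by apply: omeasure_ge0; exact: measurableI.
Qed.

Lemma oint_simple_ge0 phi : 0 <= S phi.
Proof.
have -> : 0 = S nnsfun0 by rewrite (@oint_simpleZ 0 phi) ?scale0r// => x; rewrite mul0r.
by apply: oint_simple_le => x; exact: fun_ge0.
Qed.

Lemma oint_simple_indic D (mD : measurable D) : S (indic_nnsfun R mD) = mu D.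
Proof.
(* With boolean labels both cells may be listed even if one is empty, which avoids computing the
   range of the indicator. *)
pose h x := x \in D.
have pre b : h @^-1` [set b] = if b then D else ~` D.
  rewrite /h; case: b; apply/seteqP; split => x /=.
  - exact: set_mem.
  - exact: mem_set.
  - by move=> xD /mem_set; rewrite xD.
  - by move=> xD; apply/negbTE/negP => /set_mem.
rewrite (@oint_simple_comp _ h [:: true; false] (fun b => b%:R))//.
- by rewrite big_cons big_seq1 scale1r scale0r addr0 pre.
- by move=> x; case: (h x).
- by move=> b; rewrite pre; case: b => //; exact: measurableC.
Qed.

End simple_integral.

(** * The order integral of nonnegative functions *)

Section lower_integral.
Context {d : measure_display} {X : measurableType d} {R : realType}.
Context {A : poalgType R} (mu : omeasure X A).
Local Notation S := (oint_simple mu).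
Local Notation M := {mfun X >-> R}.
Implicit Types phi psi : {nnsfun X >-> R}.

Lemma measurable_ler_set (f g : M) : measurable [set x | f x <= g x].
Proof.
have := @measurable_fun_ler _ _ _ setT _ _ (measurable_funPT f) (measurable_funPT g).
by move=> /(_ measurableT [set true]); rewrite setTI; exact.
Qed.

Lemma nnsfun_bounded phi : exists2 C : R, 0 < C & forall x, phi x <= C.
Proof.
(* The summand 1 keeps the bound positive even if [phi] vanishes, so that it can be inverted
   later. *)
have [s _ sP] := nnsfun_range phi; exists (1 + \sum_(y <- s) `|y|).
  by rewrite ltr_pwDl// sumr_ge0.
move=> x; rewrite (big_rem (phi x))//= addrCA (le_trans (ler_norm _))//.
by rewrite lerDl addr_ge0// sumr_ge0.
Qed.

Lemma oint_simple_le_indic phi (C : R) D (mD : measurable D) : 0 <= C ->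
  (forall x, phi x <= C * \1_D x) -> S phi <= C *: mu D.
Proof.
move=> C0 le; rewrite -(oint_simple_indic mu mD).
rewrite -(@oint_simpleZ _ _ _ _ _ C _ (scale_nnsfun (indic_nnsfun R mD) C0))//.
exact: oint_simple_le.
Qed.

(* For c < 1 the function c phi lies below g n except on the set {g n < c phi},
   which decreases to the empty set. *)
Lemma oint_simple_le_lim (g : nat -> M) (h : X -> R) phi b :
  (forall x, nondecreasing_seq (g ^~ x)) -> (forall n x, 0 <= g n x) ->
  (forall x, g ^~ x @ \oo --> h x) -> (forall x, phi x <= h x) ->
  (forall n psi, (forall x, psi x <= g n x) -> S psi <= b) -> S phi <= b.
Proof.
move=> ndg g0 gh phih gb.
suff H (c : R) : 0 <= c -> c < 1 -> c *: S phi <= b.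
  rewrite -subv_ge0 -[b - _]opprB -oppr0 lev_N2.
  (* For c = 1 - 1/(n+1), the claim [H] says (n+1)(S phi - b) <= S phi; the Archimedean property
     then gives S phi - b <= 0. *)
  apply: (archimedeanv _ (S phi)) => n.
  have n0 : 0 < n.+1%:R :> R by [].
  rewrite [leRHS](_ : _ = n.+1%:R *: (n.+1%:R^-1 *: S phi)); last first.
    by rewrite scalerA divff ?scale1r ?gt_eqF.
  rewrite -scaler_nat; apply: lev_Z2l; first exact: ltW.
  have /(H _) : 0 <= 1 - n.+1%:R^-1 :> R by rewrite subr_ge0 invf_le1// ler1n.
  rewrite ltrBlDr ltrDl invr_gt0 => /(_ n0).
  by rewrite scalerBl scale1r !lev_subl addrC.
move=> c0 c1; pose D n := [set x | c * phi x <= g n x].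
have mD n : measurable (D n).
  exact: (measurable_ler_set (scale_nnsfun phi c0) (g n)).
have mE n : measurable (~` D n) by exact: measurableC.
have [C C0 phiC] := nnsfun_bounded phi.
have phi0 x : 0 <= phi x by exact: fun_ge0.
(* On [D n] the function c phi is below [g n] and contributes at most [b]; on the complement it is
   at most [C]. *)
have key n : c *: S phi - b <= C *: mu (~` D n).
  rewrite lev_subl.
  have <- : S (scale_nnsfun phi c0) = c *: S phi by exact: oint_simpleZ.
  rewrite (@oint_simpleD _ _ _ _ _ (proj_nnsfun (scale_nnsfun phi c0) (mE n))
    (proj_nnsfun (scale_nnsfun phi c0) (mD n))); last first.
    by move=> x /=; rewrite -mulrDr !mindicE in_setC; case: (x \in D n);
      rewrite ?addr0 ?add0r mulr1.
  apply: lev_D.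
    apply: (oint_simple_le_indic (mE n)); first exact: ltW.
    move=> x /=; rewrite ler_wpM2r ?mindicE//.
    by rewrite (le_trans _ (phiC x))// ler_piMl// ltW.
  apply: (gb n) => x /=; rewrite mindicE.
  have [/set_mem xD|_] := boolP (x \in D n); first by rewrite mulr1.
  by rewrite mulr0.
rewrite -subv_ge0 -[b - _]opprB -oppr0 lev_N2.
rewrite [leLHS](_ : _ = C *: (C^-1 *: (c *: S phi - b))); last first.
  by rewrite scalerA divff ?scale1r ?gt_eqF.
rewrite -[leRHS](scaler0 _ C); apply: lev_Z2l; first exact: ltW.
apply: (@omeasure_down _ _ _ _ mu (fun n => ~` D n)) => //.
- by move=> n; apply: subsetC => x /le_trans; apply; exact: ndg.
- rewrite -subset0 => x xE.
  (* At a zero of [phi] the strict inequality c phi x < h x may fail, but there [x] already belongs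
     to [D 0]. *)
  have [phx|phx] := leP (phi x) 0.
    have /(_ O I) /= := xE; apply.
    by rewrite /D/= (le_trans (mulr_ge0_le0 c0 phx)).
  have /(cvgr_gt _ (gh x)) [N _ /(_ N (leqnn _))] : c * phi x < h x.
    by rewrite (lt_le_trans _ (phih x))// gtr_pMl.
  by move=> /= cN; apply: (xE N I); rewrite /D/= ltW.
- move=> n; rewrite [leRHS](_ : _ = C^-1 *: (C *: mu (~` D n))); last first.
    by rewrite scalerA mulVf ?scale1r ?gt_eqF.
  by apply: lev_Z2l (key n); rewrite invr_ge0 ltW.
Qed.

Definition simple_below (f : X -> R) : set {nnsfun X >-> R} :=
  [set phi | forall x, phi x <= f x].

(** The integral as a supremum over all simple functions below [f], free of the choice of an
    approximating sequence made in [is_oint]; [has_ointP] and [ointP] relate the two. *)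
Definition has_oint (f : X -> R) (a : A) :=
  is_sup setT (S @` simple_below f) a.

Definition nnsfun_up (phi : nat -> {nnsfun X >-> R}) (f : X -> R) :=
  (forall x, nondecreasing_seq (fun n => phi n x)) /\
  (forall x, (fun n => phi n x) @ \oo --> f x).

Lemma nnsfun_up_le (phi : nat -> {nnsfun X >-> R}) f n x : nnsfun_up phi f -> phi n x <= f x.
Proof.
move=> [nd cv]; have /cvg_lim <- // := cv x.
by apply: nondecreasing_cvgn_le (nd x) _ n; apply/cvg_ex; exists (f x).
Qed.

Lemma nnsfun_up_exists (f : M) : (forall x, 0 <= f x) ->
  exists phi : nat -> {nnsfun X >-> R}, nnsfun_up phi f.
Proof.
move=> f0; have mf : measurable_fun setT (EFin \o f).
  by apply/measurable_EFinP; exact: measurable_funPT.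
exists (nnsfun_approx measurableT mf); split=> x.
  by move=> m n mn; exact/lefP/nd_nnsfun_approx.
have f0E : forall y, [set: X] y -> (0 <= (EFin \o f) y)%E.
  by move=> y _; rewrite lee_fin.
by have /fine_cvgP[] := cvg_nnsfun_approx measurableT mf f0E (I : setT x).
Qed.

(** The two families of integrals have the same upper bounds, by [oint_simple_le_lim]. Arguing with
    bounds keeps the existence of a supremum out of the proof. *)
Lemma has_ointP (phi : nat -> {nnsfun X >-> R}) f a : nnsfun_up phi f ->
  has_oint f a <-> is_sup setT (range (S \o phi)) a.
Proof.
move=> up; suff ubE b : ubound (range (S \o phi)) b <->
    ubound (S @` simple_below f) b.
  by split=> -[_ /ubE ub lub]; split=> // b _ /ubE; exact: lub.
split=> [ub _ [psi psif <-]|ub _ [n _ <-]]; last first.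
  by apply: ub; exists (phi n) => // x; exact: nnsfun_up_le.
apply: (@oint_simple_le_lim phi f) => //.
- exact: up.1.
- exact: up.2.
- move=> n chi chin; apply: (@le_trans _ _ (S (phi n))).
    exact: oint_simple_le.
  by apply: ub; exists n.
Qed.

Lemma is_oint_up (f : X -> R) v : is_oint mu (EFin \o f) v <->
  exists2 phi : nat -> {nnsfun X >-> R}, nnsfun_up phi f & is_sup_ext (S \o phi) v.
Proof.
split=> [[phi [nd cv sup]]|[phi [nd cv] sup]]; exists phi => //.
  by split=> // x; have /fine_cvgP[] := cv x.
split=> // x; apply/fine_cvgP; split; last exact: cv.
by near=> n.
Unshelve. all: by end_near. Qed.

Lemma is_sup_extP (u : nat -> A) a :
  is_sup_ext u (Some a) <-> is_sup setT (range u) a.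
Proof.
split=> [[ub lub]|[_ ub lub]].
  split=> // [_ [n _ <-]|b _ ubb]; first exact: (ub n).
  by apply: (lub (Some b)) => n; apply: ubb; exists n.
split=> [n|[b|//]]; first by apply: ub; exists n.
by move=> ubb; apply: lub => // _ [n _ <-]; exact: (ubb n).
Qed.

Lemma ointP (f : M) a : (forall x, 0 <= f x) ->
  oint mu (fun x => (f x)%:E) = Some a <-> has_oint f a.
Proof.
move=> f0; split=> [fa|fa].
  have : is_oint mu (EFin \o f) (Some a).
    (* The default of [xget] is [None], so a value [Some a] can only come from an actual instance of
       [is_oint]. *)
    by rewrite -fa /oint; case: xgetP => // H; move: fa; rewrite /oint xgetPN.
  move=> /is_oint_up[phi up /is_sup_extP sup].
  by apply/(has_ointP _ up).
have [phi up] := nnsfun_up_exists f0.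
have oa : is_oint mu (EFin \o f) (Some a).
  by apply/is_oint_up; exists phi => //; apply/is_sup_extP/(has_ointP _ up).
apply: xget_unique => // v /is_oint_up[psi /has_ointP upsi sup].
(* [a] bounds the integrals along any other sequence [psi], which rules out the value infinity for
   it. *)
have [_ /= ubpsi _] := (upsi a).1 fa.
case: v sup => [b /is_sup_extP/upsi fb|[_ /(_ (Some a))]].
  by rewrite (is_sup_uniq fa fb).
by case => n; apply: ubpsi; exists n.
Qed.

End lower_integral.

(** * Monotonicity, arithmetic and monotone convergence for nonnegative functions *)

Section lower_integral_theory.
Context {d : measure_display} {X : measurableType d} {R : realType}.
Context {A : poalgType R} (mu : omeasure X A).
Local Notation S := (oint_simple mu).
Local Notation M := {mfun X >-> R}.
Local Notation has_oint := (has_oint mu).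
Implicit Types phi psi : {nnsfun X >-> R}.
Implicit Types (f g : X -> R).

Lemma has_oint_simple phi : has_oint phi (S phi).
Proof.
split=> // [_ [psi le <-]|b _]; first exact: oint_simple_le.
by apply; exists phi => //=.
Qed.

Lemma has_oint_ge0 f a : has_oint f a -> (forall x, 0 <= f x) -> 0 <= a.
Proof.
move=> [_ ub _] f0; apply: le_trans (oint_simple_ge0 mu nnsfun0) _.
by apply: ub; exists nnsfun0.
Qed.

(** The part of [phi] on the exceptional set [N] integrates to at most [C *: mu N = 0]. The rest is
    below [g] everywhere; on [N] it is zero, and [g >= 0] suffices. *)
Lemma simple_below_ae f g c phi : ae mu (fun x => f x <= g x) ->
  (forall x, 0 <= g x) -> ubound (S @` simple_below g) c ->
  simple_below f phi -> S phi <= c.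
Proof.
move=> [N [mN N0 fgN]] g0 ub phif.
have mC : measurable (~` N) by exact: measurableC.
rewrite (@oint_simpleD _ _ _ _ _ (proj_nnsfun phi mN) (proj_nnsfun phi mC));
  last first.
  by move=> x /=; rewrite -mulrDr !mindicE in_setC; case: (x \in N);
    rewrite ?addr0 ?add0r mulr1.
have [C C0 phiC] := nnsfun_bounded phi.
rewrite -[c]add0r; apply: lev_D.
  have : S (proj_nnsfun phi mN) <= C *: mu N.
    apply: (oint_simple_le_indic mu mN) => [|x /=]; first exact: ltW.
    by rewrite ler_wpM2r ?mindicE.
  by rewrite N0 scaler0.
apply: ub; exists (proj_nnsfun phi mC) => // x /=; rewrite mindicE.
have [/set_mem xN|_] := boolP (x \in ~` N); last by rewrite mulr0.
rewrite mulr1 (le_trans (phif x))// leNgt; apply/negP => gf.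
by apply/xN/fgN; apply/negP; rewrite -ltNge.
Qed.

Lemma has_oint_le f g a b : has_oint f a -> has_oint g b ->
  (forall x, 0 <= g x) -> ae mu (fun x => f x <= g x) -> a <= b.
Proof.
move=> [_ _ lub] [_ ub _] g0 fg; apply: lub => // _ [phi phif <-].
exact: simple_below_ae fg g0 ub phif.
Qed.

Lemma nnsfun_up_nd (phi : nat -> {nnsfun X >-> R}) f : nnsfun_up phi f ->
  nondecreasing_seq (S \o phi).
Proof. by move=> [nd _] m n mn; apply: oint_simple_le => x; exact: nd. Qed.

Lemma has_oint_exists (f : M) g b : sigma_monotone_complete [set: A] ->
  has_oint g b -> (forall x, 0 <= f x) -> (forall x, 0 <= g x) ->
  ae mu (fun x => f x <= g x) -> exists a, has_oint f a.
Proof.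
move=> cA [_ ub _] f0 g0 fg; have [phi up] := nnsfun_up_exists f0.
have [||a aE] := cA (S \o phi) (fun=> I).
- exact: nnsfun_up_nd up.
- exists b => // _ [n _ <-]; apply: simple_below_ae fg g0 ub _ => x.
  exact: nnsfun_up_le.
by exists a; apply/(has_ointP _ _ up).
Qed.

Lemma has_ointD (f g : M) a b : (forall x, 0 <= f x) -> (forall x, 0 <= g x) ->
  has_oint f a -> has_oint g b -> has_oint (fun x => f x + g x) (a + b).
Proof.
move=> f0 g0; have [phi uphi] := nnsfun_up_exists f0.
have [psi upsi] := nnsfun_up_exists g0.
move=> /(has_ointP _ _ uphi) fa /(has_ointP _ _ upsi) gb.
have up : nnsfun_up (fun n => add_nnsfun (phi n) (psi n)) (fun x => f x + g x).
  split=> x; last by apply: cvgD; [exact: uphi.2|exact: upsi.2].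
  by move=> m n mn /=; apply: lerD; [exact: uphi.1|exact: upsi.1].
apply/(has_ointP _ _ up).
rewrite (_ : _ \o _ = fun n => (S \o phi) n + (S \o psi) n).
  exact: is_sup_seqD (nnsfun_up_nd uphi) (nnsfun_up_nd upsi) fa gb.
by apply/funext => n /=; exact: oint_simpleD.
Qed.

Lemma has_ointZ (r : R) (f : M) a : 0 <= r -> (forall x, 0 <= f x) ->
  has_oint f a -> has_oint (fun x => r * f x) (r *: a).
Proof.
move=> r0 f0 fa; have [->|rN0] := eqVneq r 0.
  rewrite scale0r.
  have := has_oint_simple nnsfun0.
  rewrite (@oint_simpleZ _ _ _ _ _ 0 nnsfun0) ?scale0r// => [|x]; last first.
    by rewrite mul0r.
  by rewrite (_ : (fun x => 0 * f x) = nnsfun0)//; apply/funext => x; rewrite mul0r.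
have [phi uphi] := nnsfun_up_exists f0.
have up : nnsfun_up (fun n => scale_nnsfun (phi n) r0) (fun x => r * f x).
  split=> x; last by apply: cvgM; [exact: cvg_cst|exact: uphi.2].
  by move=> m n mn /=; apply: ler_wpM2l => //; exact: uphi.1.
apply/(has_ointP _ _ up); move: fa => /(has_ointP _ _ uphi).
have rgt0 : 0 < r by rewrite lt_neqAle eq_sym rN0.
move=> /(is_sup_seqZ rgt0) fa.
rewrite (_ : _ \o _ = fun n => r *: (S \o phi) n)//.
by apply/funext => n /=; exact: oint_simpleZ.
Qed.

Lemma has_ointM (f g : M) a b : sigma_monotone_continuous_mul A ->
  spectral mu -> (forall x, 0 <= f x) -> (forall x, 0 <= g x) ->
  has_oint f a -> has_oint g b -> has_oint (fun x => f x * g x) (a * b)%g.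
Proof.
move=> mA sp f0 g0; have [phi uphi] := nnsfun_up_exists f0.
have [psi upsi] := nnsfun_up_exists g0.
move=> fa gb; have a0 := has_oint_ge0 fa f0; have b0 := has_oint_ge0 gb g0.
move: fa gb => /(has_ointP _ _ uphi) fa /(has_ointP _ _ upsi) gb.
have up : nnsfun_up (fun n => mul_nnsfun (phi n) (psi n)) (fun x => f x * g x).
  split=> x; last by apply: cvgM; [exact: uphi.2|exact: upsi.2].
  by move=> m n mn /=; apply: ler_pM => //; [exact: uphi.1|exact: upsi.1].
apply/(has_ointP _ _ up).
have SE n : S (mul_nnsfun (phi n) (psi n)) = (S (phi n) * S (psi n))%g.
  exact: oint_simpleM.
have S0 phi' : 0 <= S phi' by exact: oint_simple_ge0.
have upf : seq_up setT (S \o phi) a by split=> //; exact: nnsfun_up_nd uphi.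
have upg : seq_up setT (S \o psi) b by split=> //; exact: nnsfun_up_nd upsi.
split=> // [_ [n _ <-]|c _ ub] /=.
  rewrite SE; apply: (@le_trans _ _ (a * S (psi n))%g).
    by apply: lev_M2r => //; case: fa => _ ubf _; apply: ubf; exists n.
  by apply: lev_M2l => //; case: gb => _ ubg _; apply: ubg; exists n.
(* Continuity of the product acts on one factor at a time: [S (psi m)] increases to [b] against the
   fixed [a], then [S (phi n)] to [a] against the fixed [S (psi m)]. Monotonicity moves the pair (n,
   m) to the diagonal. *)
have [[_ _ [_ _ lub]] _] := mA _ _ (fun n => S0 (psi n)) b0 upg _ a0.
apply: lub => // _ [m _ <-].
have [_ [_ _ [_ _ lub]]] := mA _ _ (fun n => S0 (phi n)) a0 upf _ (S0 (psi m)).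
apply: lub => // _ [n _ <-].
apply: (@le_trans _ _ (S (mul_nnsfun (phi (maxn n m)) (psi (maxn n m))))).
  rewrite SE; apply: (@le_trans _ _ (S (phi (maxn n m)) * S (psi m))%g).
    by apply: lev_M2r => //; apply: (nnsfun_up_nd uphi); exact: leq_maxl.
  by apply: lev_M2l => //; apply: (nnsfun_up_nd upsi); exact: leq_maxr.
by apply: ub; exists (maxn n m).
Qed.

(** Monotone convergence: a bound of all [a n] bounds the integral of each simple function below [f]
    by [oint_simple_le_lim], hence it bounds [b]. *)
Lemma has_oint_lim (u : nat -> M) f (a : nat -> A) b :
  (forall x, nondecreasing_seq (u ^~ x)) -> (forall n x, 0 <= u n x) ->
  (forall x, u ^~ x @ \oo --> f x) -> (forall n, has_oint (u n) (a n)) ->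
  has_oint f b -> is_sup setT (range a) b.
Proof.
move=> ndu u0 uf ua fb.
have ulef n x : u n x <= f x.
  have /cvg_lim <- // := uf x.
  by apply: nondecreasing_cvgn_le (ndu x) _ n; apply/cvg_ex; exists (f x).
split=> // [_ [n _ <-]|c _ ub].
  apply: has_oint_le (ua n) fb _ _ => [x|]; first exact: le_trans (u0 n x) _.
  exact: Defs.aeW.
case: fb => _ _ lub; apply: lub => // _ [phi phif <-].
apply: (oint_simple_le_lim ndu u0 uf phif) => n psi psiu.
apply: (@le_trans _ _ (a n)); last by apply: ub; exists n.
by case: (ua n) => _ ubn _; apply: ubn; exists psi.
Qed.

End lower_integral_theory.

(** * Integrable functions *)

Section integral.
Context {d : measure_display} {X : measurableType d} {R : realType}.
Context {A : poalgType R} (mu : omeasure X A).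
Local Notation M := {mfun X >-> R}.
Local Notation has_oint := (has_oint mu).
Implicit Types (f g h : M) (a b c : A).

Definition has_int f a := exists g h b c,
  [/\ forall x, 0 <= g x, forall x, 0 <= h x, f = g - h,
      has_oint g b /\ has_oint h c & a = b - c].

Definition absm f : M := max_mfun f (- f).

Lemma absmE f x : absm f x = `|f x|.
Proof. exact: maxrN. Qed.

Lemma absm_ge0 f x : 0 <= absm f x.
Proof. by rewrite absmE. Qed.

Lemma cL1_has_oint f : cL1 mu f <-> exists a, has_oint (absm f) a.
Proof.
have E : (fun x => `|f x|%:E) = (fun x => (absm f x)%:E).
  by apply/funext => x; rewrite absmE.
rewrite /cL1 /= E; split=> -[a aE]; exists a; apply/ointP => //; exact: absm_ge0.
Qed.

Definition posm f : M := max_mfun f 0.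
Definition negm f : M := max_mfun (- f) 0.

Lemma posm_ge0 f x : 0 <= posm f x. Proof. by rewrite /= le_max lexx orbT. Qed.
Lemma negm_ge0 f x : 0 <= negm f x. Proof. by rewrite /= le_max lexx orbT. Qed.

Lemma posmBnegm f : f = posm f - negm f.
Proof.
have maxB (t : R) : t = Num.max t 0 - Num.max (- t) 0.
  have [t0|/ltW t0] := leP 0 t; first by rewrite max_r ?oppr_le0// subr0.
  by rewrite max_l ?oppr_ge0// sub0r opprK.
by apply/mfuneqP => x; rewrite mfunB; exact: maxB.
Qed.

Lemma posm_le f x : posm f x <= absm f x.
Proof. by rewrite absmE /= ge_max ler_norm normr_ge0. Qed.

Lemma negm_le f x : negm f x <= absm f x.
Proof. by rewrite absmE /= ge_max -normrN ler_norm normr_ge0. Qed.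

Lemma has_oint_uniq (f : X -> R) a b : has_oint f a -> has_oint f b -> a = b.
Proof. exact: is_sup_uniq. Qed.

Lemma Imu_posneg f a b : has_oint (posm f) a -> has_oint (negm f) b ->
  Imu mu f = a - b.
Proof.
by move=> /ointP-/(_ (posm_ge0 f)) fa /ointP-/(_ (negm_ge0 f)) fb; rewrite /Imu fa fb.
Qed.

Hypothesis cA : sigma_monotone_complete [set: A].

Lemma has_oint_posneg f a : has_oint (absm f) a ->
  (exists p, has_oint (posm f) p) /\ (exists q, has_oint (negm f) q).
Proof.
move=> fa; split; apply: has_oint_exists cA fa _ (absm_ge0 f) _.
- exact: posm_ge0.
- by apply: Defs.aeW => x; exact: posm_le.
- exact: negm_ge0.
- by apply: Defs.aeW => x; exact: negm_le.
Qed.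

Lemma has_intP f a : has_int f a <-> cL1 mu f /\ Imu mu f = a.
Proof.
split=> [[g [h [b [c [g0 h0 fE [gb hc] ->]]]]]|[/cL1_has_oint[b fb] <-]].
  have fgh x : absm f x <= g x + h x.
    by rewrite absmE fE mfunB (le_trans (ler_normB _ _))// !ger0_norm.
  have gh0 x : 0 <= g x + h x by rewrite addr_ge0.
  have ghD := has_ointD g0 h0 gb hc.
  have [e fe] : exists e, has_oint (absm f) e.
    by apply: has_oint_exists cA ghD _ gh0 _; [exact: absm_ge0|exact: Defs.aeW].
  split; first by apply/cL1_has_oint; exists e.
  have [[p fp] [q fq]] := has_oint_posneg fe.
  rewrite (Imu_posneg fp fq).
  (* The value does not depend on the decomposition: [posm f + h] and [g + negm f] are the same
     nonnegative function, so p + c = b + q. *)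
  have := has_ointD (posm_ge0 f) h0 fp hc.
  rewrite (_ : (fun x => _ + _) = fun x => g x + negm f x); last first.
    apply/funext => x; have := congr1 (fun k : M => k x) (posmBnegm f).
    by rewrite {1}fE !mfunB/=; lra.
  move=> /has_oint_uniq/(_ (has_ointD g0 (negm_ge0 f) gb fq)) pcbq.
  by apply/eqP; rewrite subr_eq addrAC -pcbq addrK.
have [[p fp] [q fq]] := has_oint_posneg fb.
exists (posm f), (negm f), p, q; split => //.
- exact: posm_ge0.
- exact: negm_ge0.
- exact: posmBnegm.
- exact: Imu_posneg.
Qed.

Lemma has_int_Imu f : cL1 mu f -> has_int f (Imu mu f).
Proof. by move=> f1; apply/has_intP. Qed.

Lemma has_oint_int f a : (forall x, 0 <= f x) -> has_oint f a -> has_int f a.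
Proof.
move=> f0 fa; exists f, 0, a, 0; split=> //.
- by rewrite subr0.
- split=> //; have := has_ointZ (lexx 0) f0 fa.
  by rewrite scale0r; congr (is_sup _ (_ @` simple_below _) _); apply/funext => x; rewrite mul0r.
- by rewrite subr0.
Qed.

Lemma has_int_oint f : (forall x, 0 <= f x) -> cL1 mu f -> has_oint f (Imu mu f).
Proof.
move=> f0 /cL1_has_oint[a].
rewrite (_ : absm f = f).
  by move=> fa; have /has_intP[_ ->] := has_oint_int f0 fa.
by apply/mfuneqP => x; rewrite absmE ger0_norm.
Qed.

Lemma has_int_lin (r : R) f g a b : has_int f a -> has_int g b ->
  has_int (r *: f + g) (r *: a + b).
Proof.
have addI f1 f2 a1 a2 : has_int f1 a1 -> has_int f2 a2 ->
    has_int (f1 + f2) (a1 + a2).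
  move=> [g1 [h1 [b1 [c1 [g10 h10 -> [gb1 hc1] ->]]]]].
  move=> [g2 [h2 [b2 [c2 [g20 h20 -> [gb2 hc2] ->]]]]].
  exists (g1 + g2), (h1 + h2), (b1 + b2), (c1 + c2); split.
  - by move=> x; rewrite mfunD addr_ge0.
  - by move=> x; rewrite mfunD addr_ge0.
  - by rewrite opprD addrACA.
  - by split; exact: has_ointD.
  - by rewrite opprD addrACA.
move=> fa; apply: addI.
move: fa => [g1 [h1 [b1 [c1 [g10 h10 -> [gb1 hc1] ->]]]]].
have [r0|r0] := leP 0 r.
  exists (r *: g1), (r *: h1), (r *: b1), (r *: c1); split.
  - by move=> x; rewrite mfunZ mulr_ge0.
  - by move=> x; rewrite mfunZ mulr_ge0.
  - by rewrite scalerBr.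
  - by split; exact: has_ointZ.
  - by rewrite scalerBr.
(* For negative [r] the two parts exchange roles, so that both multiples stay nonnegative. *)
have rN : 0 <= - r by rewrite oppr_ge0 ltW.
exists (- r *: h1), (- r *: g1), (- r *: c1), (- r *: b1); split.
- by move=> x; rewrite mfunZ mulr_ge0.
- by move=> x; rewrite mfunZ mulr_ge0.
- by rewrite -scalerBr scaleNr -scalerN opprB.
- by split; exact: has_ointZ.
- by rewrite -scalerBr scaleNr -scalerN opprB.
Qed.

Lemma has_int_le f g a b : has_int f a -> has_int g b ->
  ae mu (fun x => f x <= g x) -> a <= b.
Proof.
move=> [g1 [h1 [b1 [c1 [g10 h10 -> [gb1 hc1] ->]]]]].
move=> [g2 [h2 [b2 [c2 [g20 h20 -> [gb2 hc2] ->]]]]] le.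
rewrite lev_subl addrAC lev_subr.
apply: (has_oint_le (has_ointD g10 h20 gb1 hc2) (has_ointD g20 h10 gb2 hc1)).
  by move=> x; rewrite addr_ge0.
by apply: aeS le => x; rewrite !mfunB/=; lra.
Qed.

Lemma has_intM f g a b : sigma_monotone_continuous_mul A -> spectral mu ->
  has_int f a -> has_int g b -> has_int (f * g) (a * b)%g.
Proof.
move=> mA sp [g1 [h1 [b1 [c1 [g10 h10 -> [gb1 hc1] ->]]]]].
move=> [g2 [h2 [b2 [c2 [g20 h20 -> [gb2 hc2] ->]]]]].
have mfunM0 (k1 k2 : M) : (forall x, 0 <= k1 x) -> (forall x, 0 <= k2 x) ->
  forall x, 0 <= (k1 * k2 : M) x by move=> k10 k20 x; rewrite mfunM mulr_ge0.
exists (g1 * g2 + h1 * h2), (g1 * h2 + h1 * g2),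
  ((b1 * b2)%g + (c1 * c2)%g), ((b1 * c2)%g + (c1 * b2)%g); split.
- by move=> x; rewrite mfunD addr_ge0//; exact: mfunM0.
- by move=> x; rewrite mfunD addr_ge0//; exact: mfunM0.
- ring.
- by split; apply: has_ointD; do ?[exact: mfunM0|exact: has_ointM].
- by rewrite mulvBr !mulvBl opprB opprD addrACA (addrC (- (c1 * b2)%g)).
Qed.

Lemma has_int_indic D (mD : measurable D) : has_int (indic_mfun D mD) (mu D).
Proof.
apply: has_oint_int => [x|]; first by rewrite /= mindicE.
by rewrite -(oint_simple_indic mu mD); exact: has_oint_simple.
Qed.

(** Domination is only almost everywhere, so that integrability also passes between representatives
    of one class. *)
Lemma cL1_dominated f g : cL1 mu g -> ae mu (fun x => `|f x| <= `|g x|) ->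
  cL1 mu f.
Proof.
move=> /cL1_has_oint[b gb] fg; apply/cL1_has_oint.
apply: has_oint_exists cA gb (absm_ge0 f) (absm_ge0 g) _.
by apply: aeS fg => x; rewrite !absmE.
Qed.

Lemma cL1_linear : linear_subspace (cL1 mu).
Proof.
split=> [|r f g /has_int_Imu fI /has_int_Imu gI].
  have : has_int 0 0.
    apply: has_oint_int => //; have := has_oint_simple mu nnsfun0.
    by rewrite (@oint_simpleZ _ _ _ _ _ 0 nnsfun0) ?scale0r// => x; rewrite mul0r.
  by case/has_intP.
by have /has_intP[] := has_int_lin r fI gI.
Qed.

Lemma Imu_linear (U : set A) : (forall f, cL1 mu f -> U (Imu mu f)) ->
  linear_operator (cL1 mu) U (Imu mu).
Proof.
move=> fU; split=> // r f g /has_int_Imu fI /has_int_Imu gI.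
by have /has_intP[] := has_int_lin r fI gI.
Qed.

Lemma Imu_le f g : cL1 mu f -> cL1 mu g -> ae mu (fun x => f x <= g x) ->
  Imu mu f <= Imu mu g.
Proof. by move=> /has_int_Imu fI /has_int_Imu gI; exact: has_int_le fI gI. Qed.

Lemma cL1_indic D (mD : measurable D) : cL1 mu (indic_mfun D mD).
Proof. by have /has_intP[] := has_int_indic mD. Qed.

Lemma Imu_indic D (mD : measurable D) : Imu mu (indic_mfun D mD) = mu D.
Proof. by have /has_intP[] := has_int_indic mD. Qed.

Lemma cL1_max f g : cL1 mu f -> cL1 mu g -> cL1 mu (max_mfun f g).
Proof.
move=> f1 g1; have absL k : cL1 mu k -> cL1 mu (absm k).
  move=> k1; apply: cL1_dominated k1 _.
  by apply: Defs.aeW => x; rewrite absmE normr_id.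
apply: (@cL1_dominated _ (absm f + absm g)).
  by apply: subspaceD; [exact: cL1_linear|exact: absL..].
apply: Defs.aeW => x.
have -> : (absm f + absm g) x = `|f x| + `|g x| by rewrite mfunD -!absmE.
rewrite [leRHS]ger0_norm ?addr_ge0//=.
by case: (leP (f x) (g x)) => _; rewrite ?lerDl ?lerDr.
Qed.

Lemma Imu_lim (u : nat -> M) f : (forall n, cL1 mu (u n)) -> cL1 mu f ->
  (forall x, nondecreasing_seq (u ^~ x)) -> (forall x, u ^~ x @ \oo --> f x) ->
  is_sup setT (range (Imu mu \o u)) (Imu mu f).
Proof.
move=> u1 f1 ndu uf.
have lI := @Imu_linear setT (fun _ _ => I).
have lB g h := @linear_operatorB _ _ _ (cL1 mu) setT _ g h cL1_linear lI.
(* Subtracting the first term gives the nonnegativity that [has_oint_lim] requires; the constant is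
   added back to the bounds at the end. *)
pose v n := u n - u 0%N.
have v0 n x : 0 <= v n x by rewrite mfunB/= subr_ge0; exact: ndu.
have v1 n : cL1 mu (v n) by apply: subspaceB => //; exact: cL1_linear.
have fx x : v ^~ x @ \oo --> (f - u 0%N) x.
  by apply: cvgB; [exact: uf|exact: cvg_cst].
have f01 : cL1 mu (f - u 0%N) by apply: subspaceB => //; exact: cL1_linear.
have f00 x : 0 <= (f - u 0%N) x.
  apply: (@cvgr_to_ge _ _ _ _ _ _ _ (fx x)); near=> n; exact: v0.
have [|_ ub lub] := has_oint_lim _ v0 fx (fun n => has_int_oint (v0 n) (v1 n))
    (has_int_oint f00 f01).
  by move=> x m n mn; rewrite /v !mfunB/= lerD2r; exact: ndu.
have vE n : Imu mu (v n) = Imu mu (u n) - Imu mu (u 0%N).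
  exact: lB (u1 n) (u1 0%N).
have fE : Imu mu (f - u 0%N) = Imu mu f - Imu mu (u 0%N).
  exact: lB f1 (u1 0%N).
split=> [//|_ [n _ <-]|c _ ubc].
  have : Imu mu (v n) <= Imu mu (f - u 0%N) by apply: ub; exists n.
  by rewrite vE fE lev_D2r.
have : Imu mu (f - u 0%N) <= c - Imu mu (u 0%N).
  apply: lub => [//|_ [n _ <-]] /=.
  by rewrite vE lev_D2r; apply: ubc; exists n.
by rewrite fE lev_D2r.
Unshelve. all: by end_near. Qed.

End integral.

(** * Spectral measures *)

Section spectral_integral.
Context {d : measure_display} {X : measurableType d} {R : realType}.
Context {A : poalgType R} (mu : omeasure X A).
Hypothesis cA : sigma_monotone_complete [set: A].
Hypothesis mA : sigma_monotone_continuous_mul A.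
Hypothesis mu_spectral : spectral mu.
Local Notation M := {mfun X >-> R}.
Local Notation I := (Imu mu).
Local Notation L := (cL1 mu).
Implicit Types (f g h : M) (a b c : A).

Let L_lin : linear_subspace L := cL1_linear mu cA.

Lemma cL1M f g : L f -> L g -> L (f * g).
Proof.
move=> /(has_int_Imu cA) fI /(has_int_Imu cA) gI.
by have /(has_intP mu cA)[] := has_intM mA mu_spectral fI gI.
Qed.

Lemma ImuM f g : L f -> L g -> I (f * g) = (I f * I g)%g.
Proof.
move=> /(has_int_Imu cA) fI /(has_int_Imu cA) gI.
by have /(has_intP mu cA)[] := has_intM mA mu_spectral fI gI.
Qed.

Lemma indic_mfunT : indic_mfun setT measurableT = 1 :> M.
Proof. by apply/mfuneqP => x; rewrite /= mindicE in_setT. Qed.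

Lemma cL1_1 : L 1.
Proof. by rewrite -indic_mfunT; exact: cL1_indic. Qed.

Lemma Imu1 : I 1 = mu setT.
Proof. by rewrite -indic_mfunT Imu_indic. Qed.

Lemma mulTImu f : L f -> (mu setT * I f)%g = I f.
Proof. by move=> f1; rewrite -Imu1 -ImuM ?mul1r//; exact: cL1_1. Qed.

Lemma mulImuT f : L f -> (I f * mu setT)%g = I f.
Proof. by move=> f1; rewrite -Imu1 -ImuM ?mulr1//; exact: cL1_1. Qed.

Lemma Imu_two_sided f : L f -> two_sided_multiples (mu setT) (I f).
Proof. by move=> f1; exists (I f) => //; rewrite mulTImu// mulImuT. Qed.

Lemma Imu_left f : L f -> left_multiples (mu setT) (I f).
Proof. by move=> f1; exists (I f) => //; rewrite mulTImu. Qed.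

Lemma Imu_right f : L f -> right_multiples (mu setT) (I f).
Proof. by move=> f1; exists (I f) => //; rewrite mulImuT. Qed.

Lemma mulTT : (mu setT * mu setT)%g = mu setT.
Proof. by rewrite -mu_spectral// setIT. Qed.

(* [b] is split along the set where [g <= f] and its complement. *)
Lemma Imu_max_le f g b : L f -> L g ->
  (mu setT * b)%g = b \/ (b * mu setT)%g = b ->
  I f <= b -> I g <= b -> I (max_mfun f g) <= b.
Proof.
move=> f1 g1 bT fb gb; pose D := [set x | g x <= f x].
have mD : measurable D by exact: measurable_ler_set.
have mC : measurable (~` D) by exact: measurableC.
pose p : M := indic_mfun D mD; pose q : M := indic_mfun (~` D) mC.
have p1 : L p by exact: cL1_indic.
have q1 : L q by exact: cL1_indic.
have maxE : max_mfun f g = p * f + q * g.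
  apply/mfuneqP => x.
  have -> : (p * f + q * g) x = (x \in D)%:R * f x + (x \in ~` D)%:R * g x.
    by rewrite mfunD /= !mindicE.
  rewrite in_setC /=; have [xD|xD] := boolP (x \in D).
    by rewrite mul1r mul0r addr0 max_l//; exact: (set_mem xD).
  rewrite mul1r mul0r add0r max_r// ltW// ltNge; apply/negP => gf.
  by move/negP: xD; apply; apply/mem_set.
have ID h k : L h -> L k -> I (h + k) = I h + I k.
  by move=> h1 k1; have := (Imu_linear cA (fun _ _ => Logic.I : setT _)).2 1 h k h1 k1;
    rewrite !scale1r.
have mu0 E : measurable E -> 0 <= mu E by exact: omeasure_ge0.
have pq : mu D + mu (~` D) = mu setT by rewrite -omeasureU ?setUv ?setICr.
case: bT => bT; rewrite -bT.
  rewrite maxE ID ?ImuM//; try exact: cL1M.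
  by rewrite !Imu_indic// -pq mulvDl lev_D// lev_M2l// mu0.
(* Functions commute, so here the indicators are moved to the right to match [b = b * mu setT]. *)
rewrite maxE [p * f]mulrC [q * g]mulrC ID ?ImuM//; try exact: cL1M.
by rewrite !Imu_indic// -pq mulvDr lev_D// lev_M2r// mu0.
Qed.

Lemma max_mfun_sup f g : L f -> L g -> is_sup L [set f; g] (max_mfun f g).
Proof.
move=> f1 g1; split; first exact: cL1_max.
  by move=> _ [->|->]; apply/le_mfunP => x /=; rewrite le_max lexx ?orbT.
move=> h _ ub; apply/le_mfunP => x /=; rewrite ge_max.
by apply/andP; split; apply/le_mfunP: x; apply: ub; [left|right].
Qed.

(** General in [U] in order to serve the three spaces of multiples of [mu setT] as well as the image
    of the integral: in each, [mu setT] fixes every element on one side, as [Imu_max_le] asks of a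
    bound. *)
Lemma Imu_sup (U : set A) f g h : (forall f, L f -> U (I f)) ->
  (forall b, U b -> (mu setT * b)%g = b \/ (b * mu setT)%g = b) ->
  L f -> L g -> is_sup L [set f; g] h -> is_sup U [set I f; I g] (I h).
Proof.
move=> LU UT f1 g1 /(is_sup_uniq (max_mfun_sup f1 g1)) <-.
split; first by apply: LU; exact: cL1_max.
  move=> _ [->|->]; apply: Imu_le => //; try exact: cL1_max.
    by apply: Defs.aeW => x /=; rewrite le_max lexx.
  by apply: Defs.aeW => x /=; rewrite le_max lexx orbT.
move=> b Ub ub; apply: Imu_max_le => //; first exact: UT.
  by apply: ub; left.
by apply: ub; right.
Qed.

Lemma Imu_preserves_moduli (U : set A) : (forall f, L f -> U (I f)) ->
  (forall b, U b -> (mu setT * b)%g = b \/ (b * mu setT)%g = b) ->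
  preserves_moduli L U I.
Proof.
move=> LU UT; have lI := Imu_linear cA LU; split=> // f m f1 sup.
rewrite /is_modulus -(linear_operatorN L_lin lI f1).
by apply: Imu_sup => //; exact: subspaceN.
Qed.

Lemma left_multiplesT b : left_multiples (mu setT) b -> (mu setT * b)%g = b.
Proof. by move=> [a _ <-]; rewrite mulgA mulTT. Qed.

Lemma right_multiplesT b : right_multiples (mu setT) b -> (b * mu setT)%g = b.
Proof. by move=> [a _ <-]; rewrite -mulgA mulTT. Qed.

Lemma two_sided_multiplesT b : two_sided_multiples (mu setT) b ->
  (mu setT * b)%g = b.
Proof. by move=> [a _ <-]; rewrite !mulgA mulTT. Qed.

Lemma cL1_vector_lattice_algebra : vector_lattice_algebra L.
Proof.
split; last exact: cL1M.
apply: vector_lattice_sup => // f g f1 g1.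
by exists (max_mfun f g); exact: max_mfun_sup.
Qed.

Lemma cL1_identity : is_identity L 1.
Proof.
by split=> [|f _]; [exact: cL1_1|rewrite !mfun_mulgE mul1r mulr1].
Qed.

Lemma cL1_commutative_unital : commutative_unital_vector_lattice_algebra L.
Proof.
split; first exact: cL1_vector_lattice_algebra.
- by move=> f g _ _; rewrite !mfun_mulgE mulrC.
- by exists 1; exact: cL1_identity.
Qed.

Let IL f : L f -> (I @` L) (I f). Proof. by exists f. Qed.

Let IL_T b : (I @` L) b -> (mu setT * b)%g = b \/ (b * mu setT)%g = b.
Proof. by move=> [f f1 <-]; left; exact: mulTImu. Qed.

Lemma Imu_image_linear : linear_subspace (I @` L).
Proof.
have lI := Imu_linear cA IL; split.
  by exists 0; [exact: L_lin.1|exact: linear_operator0 L_lin lI].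
move=> r _ _ [f f1 <-] [g g1 <-]; exists (r *: f + g); first exact: L_lin.2.
exact: lI.2.
Qed.

Lemma Imu_image_vector_lattice_algebra : vector_lattice_algebra (I @` L).
Proof.
split.
  apply: vector_lattice_sup Imu_image_linear _ => _ _ [f f1 <-] [g g1 <-].
  exists (I (max_mfun f g)); apply: Imu_sup => //; exact: max_mfun_sup.
move=> _ _ [f f1 <-] [g g1 <-]; exists (f * g); first exact: cL1M.
exact: ImuM.
Qed.

Lemma Imu_image_identity : is_identity (I @` L) (mu setT).
Proof.
split; first by exists 1; [exact: cL1_1|exact: Imu1].
by move=> _ [f f1 <-]; rewrite mulTImu// mulImuT.
Qed.

Lemma Imu_image_commutative_unital :
  commutative_unital_vector_lattice_algebra (I @` L).
Proof.
split; first exact: Imu_image_vector_lattice_algebra.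
- by move=> _ _ [f f1 <-] [g g1 <-]; rewrite -!ImuM// mulrC.
- by exists (mu setT); exact: Imu_image_identity.
Qed.

Lemma Imu_homomorphism : vector_lattice_algebra_homomorphism L (I @` L) I.
Proof.
split; last exact: ImuM.
apply: lattice_homomorphism_sup => //; first exact: Imu_image_linear.
- exact: Imu_linear.
- by move=> f g h; exact: Imu_sup.
Qed.

Lemma Imu_unital : unital_map L (I @` L) I.
Proof.
move=> e [_ eE]; have [+ _] := eE 1 cL1_1.
by rewrite mfun_mulgE mulr1 => ->; rewrite Imu1; exact: Imu_image_identity.
Qed.

Lemma Imu_kernel : L `&` [set f | I f = 0] = null_functions mu.
Proof.
apply/seteqP; split=> [f [f1 /= If0]|f /= f0]; last first.
  have L0 : L 0 by exact: L_lin.1.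
  have I0 : I 0 = 0 by exact: linear_operator0 L_lin (Imu_linear cA IL).
  have f1 : L f by apply: cL1_dominated L0 _ => //; apply: aeS f0 => x ->.
  split=> //=; apply/le_anti/andP; split; rewrite -I0;
    by apply: Imu_le => //; apply: aeS f0 => x ->.
have f1N : L (- f) by exact: subspaceN.
have lI := Imu_linear cA IL.
have a1 : L (absm f) by exact: cL1_max.
(* [0] bounds both [I f] and [I (- f)] and is fixed by [mu setT], so it also bounds the integral of
   their maximum. *)
have Ia : I (absm f) <= 0.
  apply: Imu_max_le => //; first by left; exact: mulv0.
    by rewrite If0.
  by rewrite (linear_operatorN L_lin lI f1) If0 oppr0.
(* The indicator of [E n] is at most (n+1)|f|, whose integral is at most 0; the sets [E n] together
   cover the points where [f] is nonzero. *)
pose E n := [set x | n.+1%:R^-1 <= `|f x|].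
have mE n : measurable (E n).
  rewrite (_ : E n = [set x | (cst n.+1%:R^-1 : M) x <= absm f x]).
    exact: measurable_ler_set.
  by apply/seteqP; split=> x; rewrite /E/= -absmE.
exists (\bigcup_n E n); split.
- exact: bigcupT_measurable.
- apply: null_bigcup => // n; apply/le_anti/andP; split; last exact: omeasure_ge0.
  rewrite -(Imu_indic mu cA (mE n)).
  apply: (@le_trans _ _ (I (n.+1%:R *: absm f))).
    apply: Imu_le => //; first exact: cL1_indic.
      by rewrite -[_ *: _]addr0; apply: L_lin.2 => //; exact: L_lin.1.
    apply: Defs.aeW => x; rewrite mfunZ absmE /= mindicE.
    have [/set_mem|_] := boolP (x \in E n); last by rewrite mulr_ge0.
    by rewrite /E/= -ler_pdivrMl// mulr1.
  have := lI.2 n.+1%:R _ _ a1 L_lin.1.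
  rewrite addr0 (linear_operator0 L_lin lI) addr0 => ->.
  by rewrite -(scaler0 _ n.+1%:R); exact: lev_Z2l.
- move=> x /eqP fx; have fx0 : 0 < `|f x| by rewrite normr_gt0.
  by have [n] := ltr_add_invr fx0; rewrite add0r => /ltW fxn; exists n.
Qed.

End spectral_integral.

(** * The quotient by the null functions *)

Section quotient_integral.
Context {d : measure_display} {X : measurableType d} {R : realType}.
Context {A : poalgType R} (mu : omeasure X A).
Hypothesis cA : sigma_monotone_complete [set: A].
Hypothesis mA : sigma_monotone_continuous_mul A.
Hypothesis mu_spectral : spectral mu.
Local Notation M := {mfun X >-> R}.
Local Notation Q := (mfun_ae mu).
Local Notation class := (\pi_(mfun_ae mu)%qT : M -> mfun_ae mu).
Local Notation L := (L1 mu).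
Local Notation I := (Imu_ae mu).
Implicit Types (f g h : M) (p q r : Q).

Let qind := @class_ind d X R A mu.

Lemma scale_class (k : R) f : k *: class f = class (k *: f).
Proof. exact: classZ. Qed.

Lemma mul_class f g : (class f * class g)%g = class (f * g).
Proof. exact: class_mul. Qed.

Lemma class0 : class 0 = 0.
Proof. exact: raddf0. Qed.

Lemma L1_class f : L (class f) <-> cL1 mu f.
Proof.
split=> [[g g1 /eq_class gf]|f1]; last by exists f.
by apply: cL1_dominated g1 _ => //; apply: aeS gf => x ->.
Qed.

Lemma Imu_ae_class f : cL1 mu f -> I (class f) = Imu mu f.
Proof.
move=> f1; have fE := ae_repr mu f; have r1 : cL1 mu (repr (class f)).
  by apply/L1_class; rewrite reprK; apply/L1_class.
by apply/le_anti/andP; split; apply: Imu_le => //; apply: aeS fE => x ->.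
Qed.

Lemma L1_linear : linear_subspace L.
Proof.
have [c0 cD] := cL1_linear mu cA; split; first by rewrite -class0; apply/L1_class.
move=> k; elim/qind=> f; elim/qind=> g /L1_class f1 /L1_class g1.
by rewrite scale_class -classD; apply/L1_class/cD.
Qed.

Lemma Imu_ae_linear (U : set A) : (forall q, L q -> U (I q)) ->
  linear_operator L U I.
Proof.
move=> LU; split=> // k; elim/qind=> f; elim/qind=> g.
move=> /L1_class f1 /L1_class g1; have [_ cD] := cL1_linear mu cA.
rewrite scale_class -classD !Imu_ae_class//; last exact: cD.
exact: (Imu_linear cA (fun _ _ => Logic.I : setT _)).2.
Qed.

Let I_lin : linear_operator L setT I := Imu_ae_linear (fun _ _ => Logic.I).

Lemma Imu_aeB p q : L p -> L q -> I (p - q) = I p - I q.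
Proof. exact: linear_operatorB L1_linear I_lin. Qed.

Lemma Imu_ae0 : I 0 = 0.
Proof. exact: linear_operator0 L1_linear I_lin. Qed.

Lemma Imu_ae_le p q : L p -> L q -> p <= q -> I p <= I q.
Proof.
elim/qind: p => f; elim/qind: q => g /L1_class f1 /L1_class g1.
by move=> /le_classP fg; rewrite !Imu_ae_class//; exact: Imu_le.
Qed.

Lemma Imu_ae_eq0 q : L q -> I q = 0 -> q = 0.
Proof.
elim/qind: q => f /L1_class f1; rewrite Imu_ae_class// => If0.
have : null_functions mu f by rewrite -Imu_kernel//; split.
by move=> f0; rewrite -class0; apply/eq_class; apply: aeS f0 => x ->.
Qed.

Lemma Imu_ae_inj p q : L p -> L q -> I p = I q -> p = q.
Proof.
move=> p1 q1 pq; apply/eqP; rewrite -subr_eq0; apply/eqP/Imu_ae_eq0.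
  exact: subspaceB L1_linear _ _.
by rewrite Imu_aeB// pq subrr.
Qed.

Lemma Imu_ae_image : I @` L = Imu mu @` cL1 mu.
Proof.
apply/seteqP; split=> [_ [q + <-]|_ [f f1 <-]].
  by elim/qind: q => f /L1_class f1; exists f; rewrite ?Imu_ae_class.
by exists (class f); [apply/L1_class|rewrite Imu_ae_class].
Qed.

(** A function, not just an existence statement, so that suprema of finite families can be formed by
    recursion. *)
Definition supq p q : Q := class (max_mfun (repr p) (repr q)).

Lemma supq_class f g : supq (class f) (class g) = class (max_mfun f g).
Proof.
apply/eq_class; apply: aeS (ae_and (ae_repr mu f) (ae_repr mu g)).
by move=> x [/= -> ->].
Qed.

Lemma supqP p q : L p -> L q -> is_sup L [set p; q] (supq p q).
Proof.
elim/qind: p => f; elim/qind: q => g /L1_class f1 /L1_class g1.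
rewrite supq_class; split; first by apply/L1_class/cL1_max.
  by move=> _ [->|->]; apply/le_classP/Defs.aeW => x /=; rewrite le_max lexx ?orbT.
elim/qind=> h _ ub.
have /le_classP fh : class f <= class h by apply: ub; left.
have /le_classP gh : class g <= class h by apply: ub; right.
by apply/le_classP; apply: aeS (ae_and fh gh) => x [? ?] /=; rewrite ge_max; apply/andP.
Qed.

Lemma supq_L1 p q : L p -> L q -> L (supq p q).
Proof. by move=> p1 q1; have [] := supqP p1 q1. Qed.

Lemma le_supql p q : L p -> L q -> p <= supq p q.
Proof. by move=> p1 q1; have [_ ub _] := supqP p1 q1; apply: ub; left. Qed.

Lemma le_supqr p q : L p -> L q -> q <= supq p q.
Proof. by move=> p1 q1; have [_ ub _] := supqP p1 q1; apply: ub; right. Qed.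

Lemma supq_le p q r : L p -> L q -> L r -> p <= r -> q <= r -> supq p q <= r.
Proof.
by move=> p1 q1 r1 pr qr; have [_ _ lub] := supqP p1 q1; apply: lub => // _ [->|->].
Qed.

Lemma L1_vector_lattice_algebra : vector_lattice_algebra L.
Proof.
split.
  apply: vector_lattice_sup L1_linear _ => p q p1 q1.
  by exists (supq p q); exact: supqP.
elim/qind=> f; elim/qind=> g /L1_class f1 /L1_class g1.
by rewrite mul_class; apply/L1_class/cL1M.
Qed.

Lemma Imu_ae_isomorphism :
  vector_lattice_algebra_isomorphism L (I @` L) I.
Proof.
have IL q : L q -> (I @` L) (I q) by move=> ?; exists q.
split; last first.
  split=> //; first by move=> p q /set_mem p1 /set_mem q1; exact: Imu_ae_inj.
split.
  apply: lattice_homomorphism_sup; first exact: L1_linear.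
  - by rewrite Imu_ae_image; exact: Imu_image_linear.
  - exact: Imu_ae_linear.
  - move=> p q r p1 q1 /(is_sup_uniq (supqP p1 q1)) <-.
    elim/qind: p p1 => f /L1_class f1; elim/qind: q q1 => g /L1_class g1.
    rewrite supq_class Imu_ae_image !Imu_ae_class//; last exact: cL1_max.
    have [[_ sup] _] := Imu_homomorphism cA mA mu_spectral.
    by apply: (sup _ _ _ f1 g1).1; exact: max_mfun_sup.
elim/qind=> f; elim/qind=> g /L1_class f1 /L1_class g1.
by rewrite mul_class !Imu_ae_class ?ImuM//; exact: cL1M.
Qed.

(** After subtraction of [f], the middle function lies between 0 and [h - f], where domination of
    absolute values applies. This puts pointwise limits into [L1]. *)
Lemma L1_between p q r : L p -> L r -> p <= q -> q <= r -> L q.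
Proof.
elim/qind: p => f; elim/qind: q => g; elim/qind: r => h.
move=> /L1_class f1 /L1_class h1 /le_classP fg /le_classP gh; apply/L1_class.
rewrite -[g](subrK f); apply: subspaceD => //; first exact: cL1_linear.
apply: (@cL1_dominated _ _ _ _ mu cA _ (h - f)).
  by apply: subspaceB => //; exact: cL1_linear.
apply: aeS (ae_and fg gh) => x [fgx ghx].
rewrite !mfunB/= !ger0_norm ?subr_ge0 ?lerD2r//; exact: le_trans ghx.
Qed.

Lemma mfun_exists (F : X -> R) : measurable_fun setT F ->
  exists f : M, forall x, f x = F x.
Proof. by move=> mF; exists (mfun_Sub (mem_set mF)). Qed.

(** Monotone convergence in the quotient. The inequalities between representatives are countably
    many and fail on one null set [N]; setting the representatives to zero on [N] makes them
    monotone and bounded at every point, so a measurable pointwise limit exists everywhere. *)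
Lemma L1_monotone (u : nat -> Q) q : (forall n, L (u n)) -> L q ->
  nondecreasing_seq u -> (forall n, u n <= q) ->
  exists p, [/\ L p, is_sup L (range u) p & is_sup setT (range (I \o u)) (I p)].
Proof.
move=> u1; elim/qind: q => g /L1_class g1 ndu uq.
have : forall n, exists f, u n = class f by move=> n; exists (repr (u n)); rewrite reprK.
move=> /choice[v uE].
have /ae_all ndv n : ae mu (fun x => v n x <= v n.+1 x).
  by apply/le_classP; rewrite -!uE; exact: ndu.
have /ae_all vg n : ae mu (fun x => v n x <= g x).
  by apply/le_classP; rewrite -uE.
have [N [mN N0 NP]] := ae_and ndv vg.
have mC : measurable (~` N) by exact: measurableC.
pose i : M := indic_mfun (~` N) mC.
have iE x : i x = (x \in ~` N)%:R by rewrite /= mindicE.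
have aei : ae mu (fun x => i x = 1).
  exists N; split=> // x ix; apply: contrapT => xN; apply: ix.
  by rewrite iE mem_set.
pose w n := i * v n.
have wx n x : w n x = i x * v n x by [].
have uw n : u n = class (w n).
  by rewrite uE; apply/eq_class; apply: aeS aei => x ix; rewrite wx ix mul1r.
have ndw x : nondecreasing_seq (w ^~ x).
  apply/nondecreasing_seqP => n; rewrite !wx iE.
  have [/set_mem xN|_] := boolP (x \in ~` N); last by rewrite !mul0r.
  rewrite !mul1r leNgt; apply/negP => lt; apply/xN/NP => -[/(_ n)].
  by rewrite leNgt lt.
have wg n x : w n x <= i x * g x.
  rewrite !wx iE.
  have [/set_mem xN|_] := boolP (x \in ~` N); last by rewrite !mul0r.
  rewrite !mul1r leNgt; apply/negP => lt; apply/xN/NP => -[_ /(_ n)].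
  by rewrite leNgt lt.
have cw x : w ^~ x @ \oo --> limn (w ^~ x).
  apply: nondecreasing_is_cvgn => //; exists (i x * g x) => _ [n _ <-]; exact: wg.
have [f fE] : exists f : M, forall x, f x = limn (w ^~ x).
  apply/mfun_exists/(@measurable_fun_cvg _ _ _ _ w) => // n; exact: measurable_funPT.
have wf x : w ^~ x @ \oo --> f x by rewrite fE.
have w1 n : cL1 mu (w n) by apply/L1_class; rewrite -uw.
have wlef n x : w n x <= f x by rewrite fE; apply: nondecreasing_cvgn_le => //; exact: cw.
have f1 : cL1 mu f.
  apply/L1_class/(@L1_between (u 0%N) _ (class g)) => //.
  - exact/L1_class.
  - by rewrite uw; apply/le_classP/Defs.aeW => x; exact: wlef.
  - apply/le_classP; apply: aeS aei => x ix.
    by apply: (cvgr_to_le (wf x)); near=> n; rewrite (le_trans (wg n x))// ix mul1r.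
exists (class f); split; first exact/L1_class.
  split; first exact/L1_class.
    by move=> _ [n _ <-]; rewrite uw; apply/le_classP/Defs.aeW => x; exact: wlef.
  elim/qind=> h _ ub.
  have /ae_all wh n : ae mu (fun x => w n x <= h x).
    by apply/le_classP; rewrite -uw; apply: ub; exists n.
  apply/le_classP; apply: aeS wh => x wh.
  by apply: (cvgr_to_le (wf x)); near=> n; exact: wh.
rewrite Imu_ae_class// (_ : I \o u = Imu mu \o w); first exact: Imu_lim.
by apply/funext => n /=; rewrite uw Imu_ae_class.
Unshelve. all: by end_near. Qed.

Lemma L1_sigma_dedekind_complete : sigma_dedekind_complete L.
Proof.
move=> D DL [p0 Dp0] /countable_injP[c cinj] [b b1 ub].
(* An enumeration of [D] by inverting the injection [c]; numbers outside its image on [D] get the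
   default [p0], which also lies in [D]. *)
pose e n := xget p0 [set p | D p /\ c p = n].
have De n : D (e n) by rewrite /e; case: xgetP => [p _ []|].
have eD p : D p -> exists n, e n = p.
  move=> Dp; exists (c p); apply: xget_unique => // q [Dq cq].
  by apply: cinj; rewrite ?inE.
pose w := fix w n := if n is n'.+1 then supq (w n') (e n'.+1) else e 0%N.
have e1 n : L (e n) by exact: DL.
have w1 n : L (w n) by elim: n => [|n IH] //=; exact: supq_L1.
have ndw : nondecreasing_seq w.
  by apply/nondecreasing_seqP => n /=; exact: le_supql.
have ew n : e n <= w n by case: n => [|n] //=; exact: le_supqr.
have wub q : L q -> ubound D q -> forall n, w n <= q.
  move=> q1 uq; elim=> [|n IH] /=; first by apply: uq.
  by apply: supq_le => //; apply: uq.
have [f [f1 [_ fub flub] _]] := L1_monotone w1 b1 ndw (wub b b1 ub).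
exists f; split=> // [p /eD[n <-]|q q1 uq].
  by apply: le_trans (ew n) _; apply: fub; exists n.
by apply: flub => // _ [n _ <-]; exact: wub.
Qed.

Lemma Imu_ae_positive : positive_operator L setT I.
Proof.
split=> // q q1 q0; rewrite -Imu_ae0; apply: Imu_ae_le => //.
exact: L1_linear.1.
Qed.

(* The operator side of order continuity: a decreasing family with infimum 0 is
   handled through the increasing family [u i0 - u i]. *)
Lemma Imu_ae_inf0 (J : Type) (u : J -> Q) (i0 : J) p :
  (forall i, L (u i)) -> (forall i, u i <= u i0) -> is_inf L (range u) 0 ->
  is_sup L (range (fun i => u i0 - u i)) p ->
  is_sup setT (range (fun i => I (u i0 - u i))) (I p) ->
  is_inf setT (range (I \o u)) 0.
Proof.
move=> u1 ule [_ lb glb] [p1 pub plub] [_ _ Ilub].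
(* Since [p] bounds all [u i0 - u i], the element [u i0 - p] of [L] is a lower bound of the family,
   hence at most 0. *)
have up : u i0 = p.
  have L1B q r : L q -> L r -> L (q - r) by exact: subspaceB L1_linear.
  apply/le_anti/andP; split; last first.
    apply: plub => // _ [i _ <-]; rewrite lev_subl -[leLHS]addr0 lev_D2l.
    by apply: lb; exists i.
  rewrite -subv_ge0 -[p - _]opprB -oppr0 lev_N2; apply: glb; first exact: L1B.
  move=> _ [i _ <-]; rewrite lev_subl addrC -lev_subl; apply: pub.
  by exists i.
split=> // [_ [i _ <-] /=|c _ cub].
  by rewrite -Imu_ae0; apply: Imu_ae_le => //; [exact: L1_linear.1|apply: lb; exists i].
have : I p <= I p - c.
  apply: Ilub => // _ [i _ <-]; rewrite Imu_aeB// up lev_D2l lev_N2.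
  by apply: cub; exists i.
by rewrite lev_subr -[leRHS]addr0 lev_D2l.
Qed.

Lemma Imu_ae_sigma_order_continuous : sigma_order_continuous L setT I.
Proof.
split; first exact: Imu_ae_positive.
move=> u [u1 niu inf0]; have u0 n : 0 <= u n by case: inf0 => _ lb _; apply: lb; exists n.
have L1B p q : L p -> L q -> L (p - q) by exact: subspaceB L1_linear.
have [|||f [f1 fsup Isup]] := @L1_monotone (fun n => u 0%N - u n) (u 0%N) _ (u1 0%N).
- by move=> n; exact: L1B.
- by move=> m n mn; rewrite lev_D2l lev_N2; exact: niu.
- by move=> n; rewrite lev_subl -[leLHS]addr0 lev_D2l.
split=> //; first by move=> m n mn /=; apply: Imu_ae_le => //; exact: niu.
by apply: Imu_ae_inf0 inf0 fsup Isup => // n; exact: niu.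
Qed.

End quotient_integral.

(** * Monotone complete algebras with the countable sup property *)

Section nets.
Context {d : measure_display} {X : measurableType d} {R : realType}.
Context {A : poalgType R} (mu : omeasure X A).
Hypothesis cA : sigma_monotone_complete [set: A].
Hypothesis mA : sigma_monotone_continuous_mul A.
Hypothesis mu_spectral : spectral mu.
Hypothesis mcA : monotone_complete [set: A].
Hypothesis cspA : countable_sup_property [set: A].
Local Notation Q := (mfun_ae mu).
Local Notation L := (L1 mu).
Local Notation I := (Imu_ae mu).
Implicit Types (p q r : Q).

(* [a], the supremum of the integrals, is attained along an increasing sequence
   of indices; adding one more index [i] to the sequence can only increase the
   integral of its supremum, which is bounded by [a], so by injectivity of
   [Imu_ae] it leaves the supremum unchanged. *)
Lemma L1_net (J : Type) (leJ : J -> J -> Prop) (u : J -> Q) q :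
  increasing_net L leJ u -> (forall i, 0 <= u i) -> L q ->
  (forall i, u i <= q) ->
  exists (t : nat -> J) p, [/\ is_sup L (range (u \o t)) p, is_sup L (range u) p
    & is_sup setT (range (I \o u)) (I p)].
Proof.
move=> [[[i0] refl trans dir] u1 ndu] u0 q1 uq.
have L0 : L 0 by exact: (L1_linear mu cA).1.
have Iu0 i : 0 <= I (u i) by rewrite -(Imu_ae0 mu cA); exact: Imu_ae_le.
have Iunet : increasing_net setT leJ (I \o u).
  by split=> // i j ij /=; apply: Imu_ae_le => //; exact: ndu.
have [|a asup] := mcA Iunet.
  by exists (I q) => // _ [i _ <-] /=; exact: Imu_ae_le.
have aub i : I (u i) <= a by case: asup => _ ub _; apply: ub; exists i.
have [s [_ _ slub]] := cspA (conj Iunet asup) Iu0 (le_trans (Iu0 i0) (aub i0)).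
have /choice[g gP] : forall ij : J * J, exists k, leJ ij.1 k /\ leJ ij.2 k.
  by move=> [i j]; exact: dir.
(* The indices supplied by the countable sup property need not be increasing; [chain i v] is an
   increasing sequence of indices above [i] and above every [v n]. *)
pose chain i (v : nat -> J) := fix t n :=
  if n is n'.+1 then g (t n', v n) else g (i, v 0%N).
have chain_ge i v n : leJ (v n) (chain i v n).
  by case: n => [|n]; [have [] := gP (i, v 0%N)|have [] := gP (chain i v n, v n.+1)].
have chain_nd i v : nondecreasing_seq (u \o chain i v).
  apply/nondecreasing_seqP => n /=; apply: ndu.
  by have [] := gP (chain i v n, v n.+1).
have chain_sup i v := L1_monotone cA (fun n => u1 (chain i v n)) q1
  (@chain_nd i v) (fun n => uq _).
pose t := chain i0 s; have [p [p1 psup Ipsup]] := chain_sup i0 s.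
have Ip_le r (v : nat -> J) : is_sup setT (range (I \o (u \o v))) (I r) -> I r <= a.
  by move=> [_ _ lub]; apply: lub => // _ [n _ <-]; exact: aub.
have Ip : I p = a.
  apply/le_anti/andP; split; first exact: Ip_le Ipsup.
  apply: slub => // _ [n _ <-] /=; apply: (@le_trans _ _ (I (u (t n)))).
    by apply: Imu_ae_le => //; apply: ndu; exact: chain_ge.
  by case: Ipsup => _ ub _; apply: ub; exists n.
have up i : u i <= p.
  have [r [r1 [_ rub _] Irsup]] := chain_sup i t.
  have pr : p <= r.
    case: psup => _ _ lub; apply: lub => // _ [n _ <-] /=.
    apply: (@le_trans _ _ (u (chain i t n))); last by apply: rub; exists n.
    by apply: ndu; exact: chain_ge.
  have -> : p = r.
    apply: (Imu_ae_inj cA mA mu_spectral p1 r1); apply/le_anti/andP; split.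
      exact: Imu_ae_le.
    by rewrite Ip; exact: Ip_le Irsup.
  apply: (@le_trans _ _ (u (chain i t 0%N))); last by apply: rub; exists 0%N.
  by apply: ndu; have [] := gP (i, t 0%N).
exists t, p; split=> //; last by rewrite Ip.
split=> // [_ [i _ <-]//|c c1 cub].
by case: psup => _ _ lub; apply: lub => // _ [n _ <-]; apply: cub; exists (t n).
Qed.

Lemma L1_countable_sup : countable_sup_property L.
Proof.
move=> J leJ u a [net [a1 aub alub]] u0 a0.
have [|t [p [tsup usup _]]] := L1_net net u0 a1.
  by move=> i; apply: aub; exists i.
by exists t; rewrite -(is_sup_uniq usup (And3 a1 aub alub)).
Qed.

Lemma Imu_ae_order_continuous : order_continuous L setT I.
Proof.
split; first exact: Imu_ae_positive.
move=> J leJ u [[[[i0] refl trans dir] u1 niu] inf0].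
have L1B p q : L p -> L q -> L (p - q) by exact: subspaceB (L1_linear mu cA).
have u0 i : 0 <= u i by case: inf0 => _ lb _; apply: lb; exists i.
split.
  have dirJ : directed leJ by split=> //; exists.
  by split=> // i j ij /=; apply: Imu_ae_le => //; exact: niu.
(* On the tail above [i0] the net is bounded by [u i0], so the differences [v k0 - v k] form a
   bounded increasing nonnegative net. By directedness the tail has the same lower bounds. *)
pose K := {i | leJ i0 i}.
pose k0 : K := exist _ i0 (refl i0).
pose v (k : K) := u (sval k).
have vk0 k : v k <= v k0 by apply: niu; exact: svalP.
have dirK : directed (fun k l : K => leJ (sval k) (sval l)).
  split=> [|k|k l m|k l] /=; [by exists; exact: k0|exact: refl|exact: trans|].
  have [m [km lm]] := dir (sval k) (sval l).
  by exists (exist _ m (trans _ _ _ (svalP k) km)).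
have infv : is_inf L (range v) 0.
  case: inf0 => L0 lb glb; split=> // [_ [k _ <-]|c c1 clb]; first exact: u0.
  apply: glb => // _ [i _ <-]; have [m [im i0m]] := dir i i0.
  apply: (@le_trans _ _ (u m)); last exact: niu.
  by apply: clb; exists (exist _ m i0m).
have [||||t [p [_ psup Ipsup]]] :=
  @L1_net K (fun k l => leJ (sval k) (sval l)) (fun k => v k0 - v k) (v k0).
- split=> // [k|k l kl]; first by apply: L1B; exact: u1.
  by rewrite lev_D2l lev_N2; exact: niu.
- by move=> k; rewrite subv_ge0.
- exact: u1.
- by move=> k; rewrite lev_subl -[leLHS]addr0 lev_D2l; exact: u0.
have [_ _ glb] := Imu_ae_inf0 cA (fun k => u1 (sval k)) vk0 infv psup Ipsup.
split=> // [_ [i _ <-] /=|c _ clb].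
  by rewrite -(Imu_ae0 mu cA); apply: Imu_ae_le => //; exact: (L1_linear mu cA).1.
by apply: glb => // _ [k _ <-]; apply: clb; exists (sval k).
Qed.

(** Finite suprema turn an arbitrary bounded set into an increasing net, indexed by lists of its
    elements under inclusion, to which [L1_net] applies. *)
Lemma L1_dedekind_complete : dedekind_complete L.
Proof.
move=> D DL [p0 Dp0] [b b1 bub].
have p01 : L p0 by exact: DL.
pose J := {s : seq Q | [set` s] `<=` D}.
(* Including [p0] in every supremum gives the empty list a value and makes [sup s - p0] nonnegative,
   as [L1_net] requires. *)
pose sup s : Q := foldr (@supq _ _ _ _ mu) p0 s.
have supL s : [set` s] `<=` D -> L (sup s).
  elim: s => [|q s IH] //= sD; apply: supq_L1 => //.
    by apply/DL/sD; rewrite /= mem_head.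
  by apply: IH => x xs; apply: sD; rewrite /= inE xs orbT.
have sup_le s c : [set` s] `<=` D -> L c -> p0 <= c ->
    (forall q, q \in s -> q <= c) -> sup s <= c.
  move=> + c1 p0c; elim: s => [|q s IH] //= sD sc.
  have sD' : [set` s] `<=` D by move=> x xs; apply: sD; rewrite /= inE xs orbT.
  apply: supq_le => //.
  - by apply/DL/sD; rewrite /= mem_head.
  - exact: supL.
  - by apply: sc; rewrite mem_head.
  - by apply: IH => // x xs; apply: sc; rewrite inE xs orbT.
have sup_ge s : [set` s] `<=` D -> p0 <= sup s /\ forall q, q \in s -> q <= sup s.
  elim: s => [|q s IH] //= sD.
  have sD' : [set` s] `<=` D by move=> x xs; apply: sD; rewrite /= inE xs orbT.
  have q1 : L q by apply/DL/sD; rewrite /= mem_head.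
  have [p0s qs] := IH sD'; have s1 := supL _ sD'; split.
    exact: le_trans p0s (le_supqr cA q1 s1).
  move=> x; rewrite inE => /orP[/eqP->|/qs xs]; first exact: le_supql.
  exact: le_trans xs (le_supqr cA q1 s1).
pose leJ (s t : J) := {subset sval s <= sval t}.
pose u (s : J) := sup (sval s) - p0.
have L1B p q : L p -> L q -> L (p - q) by exact: subspaceB (L1_linear mu cA).
have net : increasing_net L leJ u.
  split; first split.
  - by exists; exists [::].
  - by move=> s x.
  - by move=> s t r st tr x /st; exact: tr.
  - move=> [s sD] [t tD].
    have stD : [set` s ++ t] `<=` D.
      by move=> x /=; rewrite mem_cat => /orP[/sD|/tD].
    by exists (exist _ (s ++ t) stD); split=> x /= xs; rewrite mem_cat xs ?orbT.
  - by move=> [s sD]; apply: L1B => //; exact: supL.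
  - move=> [s sD] [t tD] st; rewrite /u lev_D2r /=; have [p0t qt] := sup_ge _ tD.
    by apply: sup_le => //; [exact: supL|move=> q /st; exact: qt].
have u0 s : 0 <= u s by rewrite subv_ge0; have [] := sup_ge _ (svalP s).
have ub c : L c -> ubound D c -> forall s, u s <= c - p0.
  move=> c1 cub [s sD]; rewrite lev_D2r /=; apply: sup_le => //; first exact: cub.
  by move=> q qs; apply/cub/sD.
have [_ [p [_ [p1 pub plub] _]]] := L1_net net u0 (L1B _ _ b1 p01) (ub b b1 bub).
exists (p + p0); split.
- exact: subspaceD (L1_linear mu cA) _ _.
- move=> q Dq; rewrite -lev_subl.
  have qD : [set` [:: q]] `<=` D by move=> x /=; rewrite inE => /eqP->.
  apply: (@le_trans _ _ (u (exist _ [:: q] qD))); last first.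
    by apply: pub; exists (exist _ [:: q] qD).
  by rewrite lev_D2r; apply: (sup_ge _ qD).2; rewrite mem_head.
- move=> c c1 cub; rewrite -lev_subr; apply: plub; first exact: L1B.
  by move=> _ [s _ <-]; exact: ub.
Qed.

End nets.

Theorem theorem4p4 (R : realType) (d : measure_display) (X : measurableType d)
    (A : poalgType R)
    (A_complete : sigma_monotone_complete [set: A])
    (A_mul : sigma_monotone_continuous_mul A)
    (mu : omeasure X A) (mu_spectral : spectral mu) :
  (forall f, cL1 mu f -> two_sided_multiples (mu setT) (Imu mu f)) /\
  [/\ preserves_moduli (cL1 mu) (left_multiples (mu setT)) (Imu mu),
      preserves_moduli (cL1 mu) (right_multiples (mu setT)) (Imu mu)
    & preserves_moduli (cL1 mu) (two_sided_multiples (mu setT)) (Imu mu)] /\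
  commutative_unital_vector_lattice_algebra (cL1 mu) /\
  [/\ commutative_unital_vector_lattice_algebra (Imu mu @` cL1 mu),
      is_identity (Imu mu @` cL1 mu) (mu setT) /\ 0 <= mu setT,
      vector_lattice_algebra_homomorphism
        (cL1 mu) (Imu mu @` cL1 mu) (Imu mu),
      unital_map (cL1 mu) (Imu mu @` cL1 mu) (Imu mu)
    & set_surj (cL1 mu) (Imu mu @` cL1 mu) (Imu mu)] /\
  [/\ cL1 mu `&` [set f | Imu mu f = 0] = null_functions mu,
      (forall f, cL1 mu f -> Imu_ae mu (\pi_(mfun_ae mu)%qT f) = Imu mu f) /\
      vector_lattice_algebra (L1 mu) /\
      vector_lattice_algebra_isomorphism
        (L1 mu) (Imu_ae mu @` L1 mu) (Imu_ae mu),
      sigma_dedekind_complete (L1 mu),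
      sigma_order_continuous (L1 mu) [set: A] (Imu_ae mu)
    & monotone_complete [set: A] -> countable_sup_property [set: A] ->
      [/\ dedekind_complete (L1 mu), countable_sup_property (L1 mu)
        & order_continuous (L1 mu) [set: A] (Imu_ae mu)]].
Proof.
have leftT := left_multiplesT mu_spectral.
have rightT := right_multiplesT mu_spectral.
have twoT := two_sided_multiplesT mu_spectral.
have two := Imu_two_sided A_complete A_mul mu_spectral.
have moduli := Imu_preserves_moduli A_complete A_mul mu_spectral.
split; first exact: two.
split.
  split; apply: moduli.
  - exact: Imu_left.
  - by move=> b /leftT; left.
  - exact: Imu_right.
  - by move=> b /rightT; right.
  - exact: two.
  - by move=> b /twoT; left.
split; first exact: cL1_commutative_unital.
split.
  split.
  - exact: Imu_image_commutative_unital.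
  - by split; [exact: Imu_image_identity|exact: omeasure_ge0].
  - exact: Imu_homomorphism.
  - exact: Imu_unital.
  - by [].
split.
- exact: Imu_kernel.
- split; first exact: Imu_ae_class.
  split; first exact: L1_vector_lattice_algebra.
  exact: Imu_ae_isomorphism.
- exact: L1_sigma_dedekind_complete.
- exact: Imu_ae_sigma_order_continuous.
- move=> mcA cspA; split.
  + exact: L1_dedekind_complete.
  + exact: L1_countable_sup.
  + exact: Imu_ae_order_continuous.
Qed.
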